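(* Let $\sigma>0$, let $\mu$ be the normalized Haar probability measure on $\mathrm{SO}(2)$, let $T_1 : C_{+}(\mathrm{SO}(2)) \to C_{+}(\mathrm{SO}(2))$ be the time-1 heat operator $T_1=e^{L}$ with $L=\tfrac{\sigma^2}{2}\Delta_{\mathrm{SO}(2)}$, and let $k_1$ be the smooth, strictly positive heat kernel of $T_1$, so that $(T_1 f)(R)=\int_{\mathrm{SO}(2)} k_1(R,\tilde R)\,f(\tilde R)\,d\mu(\tilde R)$. Let $\rho_0,\rho_1$ be probability density functions on $\mathrm{SO}(2)$ with respect to $\mu$ (the initial and terminal PDFs) such that $\rho_0,\rho_1\in C_{+}(\mathrm{SO}(2))$. Then there exist $\varphi_1,\psi_0\in C_{+}(\mathrm{SO}(2))$ satisfying the Schrödinger system of equations $$\psi_0=\frac{\rho_0}{T_1\varphi_1},\qquad \varphi_1=\frac{\rho_1}{T_1\psi_0}$$ (quotients taken pointwise). Moreover, this solution is unique up to multiplication of $\varphi_1$ and division of $\psi_0$ by the same positive constant; that is, if $(\varphi_1,\psi_0)$ and $(\varphi_1',\psi_0')$ are two solutions in $C_{+}(\mathrm{SO}(2))\times C_{+}(\mathrm{SO}(2))$, then there is a constant $a>0$ with $\varphi_1'=a\,\varphi_1$ and $\psi_0'=\psi_0/a$.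
   Context: $\mathrm{SO}(2)$ is the compact Lie group of $2\times 2$ real orthogonal matrices of determinant $1$, with Lie algebra $\mathfrak{so}(2)$ of real skew-symmetric $2\times2$ matrices. An $\mathrm{Ad}$-invariant inner product on $\mathfrak{so}(2)$ is fixed and $\mathrm{SO}(2)$ is equipped with the induced bi-invariant Riemannian metric. $\mu$ is the normalized Haar probability measure (the Riemannian volume, normalized). $\Delta_{\mathrm{SO}(2)}$ is the Laplace–Beltrami operator, $\Delta_{\mathrm{SO}(2)} f=\operatorname{div}(\operatorname{grad} f)$ for smooth $f$. For fixed $\sigma>0$ (the diffusion strength), $L=\tfrac{\sigma^2}{2}\Delta_{\mathrm{SO}(2)}$ and $(T_t)_{0\le t\le1}=(e^{tL})_{0\le t\le 1}$ is the heat semigroup on $L^2(\mathrm{SO}(2),\mu)$, with heat kernel $k_t$: $(T_tf)(R)=\int_{\mathrm{SO}(2)}k_t(R,\tilde R)f(\tilde R)\,d\mu(\tilde R)$. $C(\mathrm{SO}(2))$ is the space of real-valued continuous functions on $\mathrm{SO}(2)$, and $C_{+}(\mathrm{SO}(2))=\{f\in C(\mathrm{SO}(2)) : f(R)>0 \text{ for all } R\in \mathrm{SO}(2)\}$. The operator $T_1$ is restricted to $C_{+}(\mathrm{SO}(2))$, which it maps into $C_{+}(\mathrm{SO}(2))$. A probability density function (PDF) on $\mathrm{SO}(2)$ is a function $\rho:\mathrm{SO}(2)\to\mathbb{R}_{\ge0}$ with $\int_{\mathrm{SO}(2)}\rho\,d\mu=1$ (with finite second moment with respect to the Riemannian distance,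 $\int_{\mathrm{SO}(2)} d(R,R_0)^2\rho(R)\,d\mu(R)<\infty$ for a fixed reference point $R_0$, which is automatic here by compactness). *)

(* Defs.v *)
From HB Require Import structures.
From mathcomp Require Import all_boot all_order all_algebra.
From mathcomp Require Import all_classical all_reals all_analysis.

Set Implicit Arguments.
Unset Strict Implicit.
Unset Printing Implicit Defensive.
Import Order.TTheory GRing.Theory Num.Theory.
Import numFieldNormedType.Exports.

Local Open Scope classical_set_scope.
Local Open Scope ring_scope.

Definition SO2_set (R : realType) : set 'M[R]_2 :=
  [set A | A *m A^T = 1%:M /\ \det A = 1].

Definition SO2 (R : realType) : Type := set_type (@SO2_set R).

Section SO2_group.
Context {R : realType}.
Implicit Types (g h : SO2 R) (A B X : 'M[R]_2).

Definition mxSO2 g : 'M[R]_2 := sval g.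

Lemma SO2_one_subproof : (1%:M : 'M[R]_2) \in @SO2_set R.
Proof. by apply/mem_set; split; rewrite ?trmx1 ?mulmx1 ?det1. Qed.

Definition oneSO2 : SO2 R :=
  exist (fun A => A \in @SO2_set R) _ SO2_one_subproof.

Lemma SO2_mul_subproof g h : mxSO2 g *m mxSO2 h \in @SO2_set R.
Proof.
have [[AA dA] [BB dB]] := (set_mem (svalP g), set_mem (svalP h)).
apply/mem_set; split.
  by rewrite trmx_mul mulmxA -(mulmxA (mxSO2 g)) BB mulmx1.
by rewrite det_mulmx dA dB mulr1.
Qed.

Definition mulSO2 g h : SO2 R :=
  exist (fun A => A \in @SO2_set R) _ (SO2_mul_subproof g h).

Definition rotmx (t : R) : 'M[R]_2 :=
  \matrix_(i < 2, j < 2)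
    if i == j then cos t else if i == 0 then - sin t else sin t.

Lemma SO2_rot_subproof (t : R) : rotmx t \in @SO2_set R.
Proof.
apply/mem_set; split; last first.
  rewrite (expand_det_row _ 0) !big_ord_recl big_ord0 /cofactor !det_mx11 !mxE /=.
  by rewrite addr0 expr0 expr1 !mul1r mulN1r mulrN mulNr opprK -!expr2 cos2Dsin2.
apply/matrixP => i j; rewrite !mxE big_ord_recl big_ord1 !mxE.
have sqD := cos2Dsin2 t; rewrite !expr2 in sqD.
case: i => [[|[|//]] ?]; case: j => [[|[|//]] ?] /=.
- by rewrite mulrNN sqD.
- by rewrite mulNr [sin t * _]mulrC subrr.
- by rewrite mulrN [sin t * _]mulrC subrr.
- by rewrite addrC sqD.
Qed.

(* [rotSO2] is a smooth covering homomorphism from the real line onto SO(2). *)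
Definition rotSO2 (t : R) : SO2 R :=
  exist (fun A => A \in @SO2_set R) _ (SO2_rot_subproof t).

End SO2_group.

HB.instance Definition _ (R : realType) :=
  PseudoMetric.copy (SO2 R) (set_type (@SO2_set R)).
HB.instance Definition _ (R : realType) := isPointed.Build (SO2 R) oneSO2.

(* SO(2) carries its Borel sigma-algebra. *)
HB.instance Definition _ (R : realType) :=
  @isMeasurable.Build (sigma_display (@open (SO2 R))) (SO2 R)
    <<s @open (SO2 R) >> (@sigma_algebra0 _ setT _)
    (@sigma_algebraC (SO2 R) _) (@sigma_algebra_bigcup _ setT _).

Section Smooth.
Context {R : realType}.

Fixpoint is_Cn {V : normedModType R} (n : nat) (f : V -> R) : Prop :=
  continuous f /\
  if n is m.+1 then
    forall v : V, (forall x, derivable f x v) /\ is_Cn m (fun x => 'D_v f x)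
  else True.

(* As [rotSO2] is a local diffeomorphism onto SO(2), smoothness on SO(2) or on
   SO(2) x SO(2) can be read in angular coordinates. *)
Definition smooth (f : SO2 R -> R) : Prop :=
  forall n, is_Cn n (fun t : R => f (rotSO2 t)).

Definition smooth2 (k : SO2 R -> SO2 R -> R) : Prop :=
  forall n, is_Cn n (fun t : R * R => k (rotSO2 t.1) (rotSO2 t.2)).

End Smooth.

Section Riemannian.
Context {R : realType}.

Definition so2 : set 'M[R]_2 := [set X | X^T = - X].

Definition Ad (g : SO2 R) (X : 'M[R]_2) : 'M[R]_2 :=
  mxSO2 g *m X *m invmx (mxSO2 g).

(* Only the values of [ip] on so(2) matter. *)
Record Ad_invariant_inner_product (ip : 'M[R]_2 -> 'M[R]_2 -> R) : Prop := {
  ip_sym : forall X Y, so2 X -> so2 Y -> ip X Y = ip Y X;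
  ip_linear : forall (a : R) X Y Z, so2 X -> so2 Y -> so2 Z ->
    ip (a *: X + Y) Z = a * ip X Z + ip Y Z;
  ip_pos : forall X, so2 X -> X != 0 -> 0 < ip X X;
  ip_Ad : forall g X Y, so2 X -> so2 Y -> ip (Ad g X) (Ad g Y) = ip X Y
}.

(* Exponential map of SO(2): for X in so(2) with lower left entry a, the matrix
   exponential of X is the rotation of angle a. *)
Definition expSO2 (X : 'M[R]_2) : SO2 R := rotSO2 (X 1 0).

(* Differential of f at g applied to the tangent vector g X, X in so(2). *)
Definition dSO2 (f : SO2 R -> R) (g : SO2 R) (X : 'M[R]_2) : R :=
  derive1 (fun s : R => f (mulSO2 g (expSO2 (s *: X)))) 0.

Variables (ip : 'M[R]_2 -> 'M[R]_2 -> R) (mu : probability (SO2 R) R).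

Definition is_haar : Prop :=
  forall (g : SO2 R) (A : set (SO2 R)), measurable A ->
    mu (mulSO2 g @^-1` A) = mu A.

(* A vector field is given in left trivialization: V : SO2 R -> 'M[R]_2 with
   values in so(2) stands for the field g |-> g V(g), and the inner product of
   g X and g Y in the tangent space at g is ip X Y. *)
Definition is_grad (f : SO2 R -> R) (V : SO2 R -> 'M[R]_2) : Prop :=
  forall g, so2 (V g) /\ forall X, so2 X -> ip (V g) X = dSO2 f g X.

(* The Riemannian divergence, determined by the divergence theorem against
   test functions; the Riemannian volume is a constant multiple of [mu], and
   the constant cancels. *)
Definition is_div (V : SO2 R -> 'M[R]_2) (u : SO2 R -> R) : Prop :=
  smooth u /\
  forall h, smooth h ->
    \int[mu]_g (u g * h g) = - \int[mu]_g dSO2 h g (V g).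

(* u is the Laplace-Beltrami operator div (grad f) of the smooth function f. *)
Definition is_laplacian (f u : SO2 R -> R) : Prop :=
  smooth f /\ exists V, is_grad f V /\ is_div V u.

(* Elements of L^2 are given by representatives. *)
Definition L2 : Type := LfunType mu (lee1n 2).

Definition L2norm (f : SO2 R -> R) : \bar R := 'N[mu]_(2%:E)[EFin \o f].

(* The semigroup (e^{tL}), 0 <= t <= 1, of L = (sigma^2 / 2) Delta: a strongly
   continuous semigroup of bounded operators of L^2 whose generator extends L
   on smooth functions. As L on smooth functions is essentially self-adjoint
   and bounded above, its closure is a generator, and a generator has no proper
   extension that is a generator; so these conditions determine the
   semigroup. *)
Record heat_semigroup (sigma : R) (T : R -> L2 -> L2) : Prop := {
  heat_linear : forall t : R, 0 <= t <= 1 -> forall (a : R) (f h : L2),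
    T t (a *: f + h) = a *: T t f + T t h %[ae mu];
  heat_bounded : forall t : R, 0 <= t <= 1 -> exists C : R, forall f : L2,
    (L2norm (T t f) <= C%:E * L2norm f)%E;
  heat_zero : forall f : L2, T 0 f = f %[ae mu];
  heat_add : forall s t : R, 0 <= s -> 0 <= t -> s + t <= 1 -> forall f : L2,
    T (s + t) f = T s (T t f) %[ae mu];
  heat_continuous : forall f : L2,
    L2norm (T t f - f) @[t --> 0^'+] --> 0%E;
  heat_generator : forall f u : L2, is_laplacian f u ->
    L2norm (t^-1 *: (T t f - f) - (sigma ^+ 2 / 2) *: u) @[t --> 0^'+] --> 0%E
}.

Definition kernel_op (k : SO2 R -> SO2 R -> R) (f : SO2 R -> R) : SO2 R -> R :=
  fun g => \int[mu]_h (k g h * f h).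

Definition is_kernel_of (k : SO2 R -> SO2 R -> R) (S : L2 -> L2) : Prop :=
  forall f : L2, S f = kernel_op k f %[ae mu].

Definition Cplus : set (SO2 R -> R) :=
  [set f : SO2 R -> R | continuous f /\ forall g, 0 < f g].

(* No moment condition: SO(2) is compact. *)
Definition is_pdf (rho : SO2 R -> R) : Prop :=
  [/\ measurable_fun setT rho, forall g, 0 <= rho g
    & (\int[mu]_g (rho g)%:E = 1)%E].

(* T1 is the time-1 heat operator. *)
Definition schrodinger_system (T1 : (SO2 R -> R) -> SO2 R -> R)
    (rho0 rho1 phi1 psi0 : SO2 R -> R) : Prop :=
  (forall g, psi0 g = rho0 g / T1 phi1 g) /\
  (forall g, phi1 g = rho1 g / T1 psi0 g).

End Riemannian.

(* Main.v *)
Require Import Defs.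
From mathcomp Require Import finmap.
From mathcomp Require Import all_boot all_order all_algebra.
From mathcomp Require Import all_classical all_reals all_analysis.
From mathcomp Require Import measurable_realfun.
From mathcomp Require Import ring lra.
Set Implicit Arguments.
Unset Strict Implicit.
Unset Printing Implicit Defensive.
Import Order.TTheory GRing.Theory Num.Theory.
Import numFieldNormedType.Exports.
Local Open Scope classical_set_scope.
Local Open Scope ring_scope.

(** With [F phi = rho1 / T1 (rho0 / T1 phi)], a pair [(phi1, psi0)] solves the
    system exactly when [phi1] is a fixed point of [F] and
    [psi0 = rho0 / T1 phi1].  So [F] must be shown to have a fixed point among
    positive continuous functions, unique up to a positive factor.

    Contraction.  By compactness the kernel lies between two constants
    [0 < a <= b].  If [m g <= f <= M g], then a Doeblin minorization places
    [T1 f / T1 g] in a subinterval of [[m, M]] whose length is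
    [(1 - a / b) (M - m)] ([kernel_op_contraction]).  The map [F] alternates
    [T1] with pointwise inversions, which exchange the two bounds, so it shrinks
    the interval of ratios by the same factor
    ([schrodinger_map_contraction]).  The ratio of two fixed points therefore
    has oscillation zero ([schrodinger_map_unique]).

    Existence.  The iterates [phi_n] of [F] have [phi_(n+1) / phi_n] in nested
    intervals of geometrically decreasing length.  This alone would only yield
    [F phi = lambda phi].  As the kernel is symmetric and [rho0], [rho1] have
    the same mass, [1] lies in each of these intervals
    ([schrodinger_map_mass]); so [ln phi_n] converges uniformly at a geometric
    rate, and its limit is a fixed point ([schrodinger_map_fixpoint]).

    Symmetry of the kernel.  It has to be extracted from the description of the
    semigroup by its generator.  Integration by parts against Haar measure
    shows that [t |-> cos (n t + c)] is an eigenfunction of the Laplacian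
    ([trigSO2_laplacian]), hence of [T1] ([semigroup_eigenvector]).  So the
    integral over [h] of [k (g, h) cos (n (h - b))] is
    [exp (- l_n) cos (n (g - b))], which is symmetric in [g] and [b].  Linear
    combinations of these cosines include the powers of
    [(1 + cos (h - b)) / 2], which concentrate at [h = b]; in the limit [k]
    itself is symmetric ([heat_kernel_sym]).

    The delicate point in [semigroup_eigenvector] is that the operators are
    bounded one time at a time.  A uniform bound on some time interval
    arbitrarily close to [0] follows from Baire's theorem on the time axis
    ([semigroup_locally_bounded]). *)

(** * Continuity of real functions *)
Section continuous_functions.
Context {R : realType} {T : topologicalType}.
Implicit Types f g : T -> R.

Lemma cont_cst (a : R) : continuous (fun _ : T => a).
Proof. by move=> x; exact: cst_continuous. Qed.

Lemma contD f g : continuous f -> continuous g ->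
  continuous (fun x => f x + g x).
Proof. by move=> fc gc x; exact: (continuousD (fc x) (gc x)). Qed.

Lemma contB f g : continuous f -> continuous g ->
  continuous (fun x => f x - g x).
Proof. by move=> fc gc x; exact: (continuousB (fc x) (gc x)). Qed.

Lemma contM f g : continuous f -> continuous g ->
  continuous (fun x => f x * g x).
Proof. by move=> fc gc x; exact: (continuousM (fc x) (gc x)). Qed.

Lemma contX f n : continuous f -> continuous (fun x => f x ^+ n).
Proof.
move=> fc; elim: n => [|n IH].
  by rewrite (_ : (fun x => _) = (fun _ => 1)) //; exact: cont_cst.
rewrite (_ : (fun x => _) = (fun x => f x * f x ^+ n)); first exact: contM.
by apply/funext => x; rewrite exprS.
Qed.

Lemma contV f : continuous f -> (forall x, f x != 0) ->
  continuous (fun x => (f x)^-1).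
Proof. by move=> fc f0 x; exact: (continuousV (f0 x) (fc x)). Qed.

Lemma cont_comp {U V : topologicalType} (h : T -> U) (k : U -> V) :
  continuous h -> continuous k -> continuous (fun x => k (h x)).
Proof. by move=> hc kc x; exact: (continuous_comp (hc x) (kc (h x))). Qed.

Lemma cvg_near_eq {U : topologicalType} (f g : T -> U) (x : T) (l : U) :
  (\forall y \near x, f y = g y) -> f @ x --> l -> g @ x --> l.
Proof.
by move=> fg; apply: cvg_trans; apply: near_eq_cvg; exact: fg.
Qed.

End continuous_functions.

Lemma cvg_pair_map {A B U V : topologicalType} (f : A -> U) (g : B -> V)
    (a : A) (b : B) (u : U) (v : V) :
  f @ a --> u -> g @ b --> v -> (f z.1, g z.2) @[z --> (a, b)] --> (u, v).
Proof.
move=> fu gv; apply: cvg_pair.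
  by apply: (cvg_comp fst f) fu; exact: cvg_fst.
by apply: (cvg_comp snd g) gv; exact: cvg_snd.
Qed.

Lemma pair_continuousr {T U : topologicalType} (x : T) :
  continuous (fun y : U => (x, y)).
Proof. by move=> y; apply: cvg_pair; [exact: cvg_cst|exact: cvg_id]. Qed.

Lemma pair_continuousl {T U : topologicalType} (y : U) :
  continuous (fun x : T => (x, y)).
Proof. by move=> x; apply: cvg_pair; [exact: cvg_id|exact: cvg_cst]. Qed.

Lemma fst_continuous {T U : topologicalType} : continuous (@fst T U).
Proof. by move=> x; exact: cvg_fst. Qed.

Lemma snd_continuous {T U : topologicalType} : continuous (@snd T U).
Proof. by move=> x; exact: cvg_snd. Qed.

(** * The circle group in angular coordinates *)
Section circle_group.
Context {R : realType}.
Implicit Types (g h : SO2 R) (s t : R).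

Definition cosSO2 g : R := mxSO2 g 0 0.
Definition sinSO2 g : R := mxSO2 g 1 0.

(** Orthogonality and unit determinant force
    [(a - d)^2 + (b + c)^2 = |A|^2 - 2 det A = 0], so the first column
    determines the matrix. *)
Lemma SO2_entries g :
  [/\ mxSO2 g 0 1 = - sinSO2 g, mxSO2 g 1 1 = cosSO2 g
    & cosSO2 g ^+ 2 + sinSO2 g ^+ 2 = 1].
Proof.
have [AA dA] := set_mem (svalP g).
move/matrixP : AA => AA; rewrite -/(mxSO2 g) in AA dA.
have := AA 0 0; have := AA 1 1.
rewrite !mxE !big_ord_recl !big_ord0 !mxE /=.
move: dA; rewrite (expand_det_row _ 0) !big_ord_recl big_ord0 /cofactor.
rewrite !det_mx11 !mxE /= addr0 expr0 expr1 mul1r mulN1r.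
rewrite /cosSO2 /sinSO2.
have L (i : 'I_2) (k : 'I_1) : lift i k = if i == 0 then 1 else 0.
  by rewrite [k]ord1; case: i => [[|[|//]] i]; exact/val_inj.
rewrite !L /=.
set a := fun_of_matrix _ 0 0; set b := fun_of_matrix _ 0 1.
set c := fun_of_matrix _ 1 0; set d := fun_of_matrix _ 1 1.
move=> dA cd ab.
have : (a - d) ^+ 2 + (b + c) ^+ 2 = 0.
  have -> : (a - d) ^+ 2 + (b + c) ^+ 2 =
   (a * a + (b * b + 0)) + (c * c + (d * d + 0)) - 2 * (a * d + b * - c) by ring.
  by rewrite dA ab cd; ring.
move/eqP; rewrite paddr_eq0 ?sqr_ge0// !sqrf_eq0 => /andP[/eqP ad /eqP bc].
have -> : b = - c by move: bc; lra.
have da : d = a by move: ad; lra.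
by split => //; rewrite -da; move: cd; rewrite !expr2; lra.
Qed.

Lemma cosSO2D1 g : cosSO2 g ^+ 2 + sinSO2 g ^+ 2 = 1.
Proof. by have [] := SO2_entries g. Qed.

Lemma SO2_inj g h : cosSO2 g = cosSO2 h -> sinSO2 g = sinSO2 h -> g = h.
Proof.
move=> cgh sgh; apply/val_inj/matrixP => i j /=.
have [g01 g11 _] := SO2_entries g; have [h01 h11 _] := SO2_entries h.
case: i => [[|[|//]] i]; case: j => [[|[|//]] j] /=.
- rewrite (_ : Ordinal i = 0); last exact/val_inj.
  rewrite (_ : Ordinal j = 0); last exact/val_inj.
  exact: cgh.
- rewrite (_ : Ordinal i = 0); last exact/val_inj.
  rewrite (_ : Ordinal j = 1); last exact/val_inj.
  by rewrite [LHS]g01 [RHS]h01 sgh.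
- rewrite (_ : Ordinal i = 1); last exact/val_inj.
  rewrite (_ : Ordinal j = 0); last exact/val_inj.
  exact: sgh.
- rewrite (_ : Ordinal i = 1); last exact/val_inj.
  rewrite (_ : Ordinal j = 1); last exact/val_inj.
  by rewrite [LHS]g11 [RHS]h11 cgh.
Qed.

Lemma cosSO2_rot t : cosSO2 (rotSO2 t) = cos t.
Proof. by rewrite /cosSO2 /= mxE. Qed.

Lemma sinSO2_rot t : sinSO2 (rotSO2 t) = sin t.
Proof. by rewrite /sinSO2 /= mxE. Qed.

Lemma rotSO2_surj g : exists t, - pi <= t <= pi /\ g = rotSO2 t.
Proof.
have cs := cosSO2D1 g.
have c1 : -1 <= cosSO2 g <= 1.
  by rewrite -ler_norml -(expr_le1 (n := 2))// -normrX ger0_norm ?sqr_ge0// -cs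
    lerDl sqr_ge0.
have a0 := acos_ge0 c1; have a1 := acos_lepi c1.
have cK : cos (acos (cosSO2 g)) = cosSO2 g by rewrite acosK// in_itv.
have sK : sin (acos (cosSO2 g)) = `|sinSO2 g|.
  by rewrite sin_acos// -cs [X in Num.sqrt X](_ : _ = sinSO2 g ^+ 2)
    ?sqrtr_sqr//; ring.
have [s0|s0] := leP 0 (sinSO2 g).
  exists (acos (cosSO2 g)); split; first by rewrite a1 andbT; lra.
  by apply: SO2_inj; rewrite ?cosSO2_rot ?sinSO2_rot// sK ger0_norm.
exists (- acos (cosSO2 g)); split; first by apply/andP; split; lra.
apply: SO2_inj; rewrite ?cosSO2_rot ?sinSO2_rot ?cosN ?sinN// sK ltr0_norm//.
by rewrite opprK.
Qed.

Lemma cosSO2M g h :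
  cosSO2 (mulSO2 g h) = cosSO2 g * cosSO2 h - sinSO2 g * sinSO2 h.
Proof.
have [g01 _ _] := SO2_entries g.
rewrite /cosSO2 /= mxE !big_ord_recl big_ord0 addr0.
rewrite (_ : lift ord0 ord0 = 1); last exact/val_inj.
by rewrite g01 mulNr.
Qed.

Lemma sinSO2M g h :
  sinSO2 (mulSO2 g h) = sinSO2 g * cosSO2 h + cosSO2 g * sinSO2 h.
Proof.
have [_ g11 _] := SO2_entries g.
rewrite /sinSO2 /= mxE !big_ord_recl big_ord0 addr0.
rewrite (_ : lift ord0 ord0 = 1); last exact/val_inj.
by rewrite g11.
Qed.

Lemma rotSO2D s t : rotSO2 (s + t) = mulSO2 (rotSO2 s) (rotSO2 t).
Proof.
apply: SO2_inj; rewrite ?cosSO2M ?sinSO2M !cosSO2_rot !sinSO2_rot.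
  exact: cosD.
exact: sinD.
Qed.

Lemma mulSO2C g h : mulSO2 g h = mulSO2 h g.
Proof. by apply: SO2_inj; rewrite ?cosSO2M ?sinSO2M; ring. Qed.

Lemma mulSO2A f g h : mulSO2 f (mulSO2 g h) = mulSO2 (mulSO2 f g) h.
Proof. by apply: SO2_inj; rewrite !(cosSO2M, sinSO2M); ring. Qed.

Lemma rotSO20 : rotSO2 0 = oneSO2 :> SO2 R.
Proof.
by apply: SO2_inj; rewrite ?cosSO2_rot ?sinSO2_rot ?cos0 ?sin0
  /cosSO2 /sinSO2 /= mxE.
Qed.

Lemma mulSO21 g : mulSO2 g oneSO2 = g.
Proof. by apply/val_inj; rewrite /= mulmx1. Qed.

Lemma cosSO2_1 : cosSO2 oneSO2 = 1.
Proof. by rewrite -rotSO20 cosSO2_rot cos0. Qed.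

Lemma mxSO2_continuous : continuous (@mxSO2 R).
Proof. exact: initial_continuous. Qed.

Lemma cosSO2_continuous : continuous cosSO2.
Proof.
move=> g; apply: (@continuous_comp _ _ _ (@mxSO2 R) (fun M => M 0 0)).
  exact: mxSO2_continuous.
exact: coord_continuous.
Qed.

Lemma sinSO2_continuous : continuous sinSO2.
Proof.
move=> g; apply: (@continuous_comp _ _ _ (@mxSO2 R) (fun M => M 1 0)).
  exact: mxSO2_continuous.
exact: coord_continuous.
Qed.

Lemma cvg_SO2 (T : Type) (F : set_system T) (FF : Filter F) (f : T -> SO2 R) g :
  cosSO2 (f x) @[x --> F] --> cosSO2 g ->
  sinSO2 (f x) @[x --> F] --> sinSO2 g -> f @ F --> g.
Proof.
move=> fc fs U [_ [[W oW <-]]] /= Wg WU.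
have [P nP PW] : nbhs (mxSO2 g) W by exact: open_nbhs_nbhs.
have [g01 g11 _] := SO2_entries g.
have h00 : \forall x \near F, P 0 0 (cosSO2 (f x)).
  by apply: fc; exact: nP.
have h11 : \forall x \near F, P 1 1 (cosSO2 (f x)).
  by apply: fc; rewrite -g11; exact: nP.
have h10 : \forall x \near F, P 1 0 (sinSO2 (f x)).
  by apply: fs; exact: nP.
have h01 : \forall x \near F, P 0 1 (- sinSO2 (f x)).
  have : - sinSO2 (f x) @[x --> F] --> - sinSO2 g by exact: cvgN.
  by apply; rewrite -g01; exact: nP.
apply: filterS (filterI (filterI h00 h11) (filterI h10 h01)).
move=> x [[x00 x11] [x10 x01]]; apply: WU; apply: PW.
have [f01 f11 _] := SO2_entries (f x).
case=> [[|[|//]] i] [[|[|//]] j].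
- rewrite (_ : Ordinal i = 0); last exact/val_inj.
  by rewrite (_ : Ordinal j = 0); last exact/val_inj.
- rewrite (_ : Ordinal i = 0); last exact/val_inj.
  by rewrite (_ : Ordinal j = 1); [rewrite [X in P _ _ X]f01|exact/val_inj].
- rewrite (_ : Ordinal i = 1); last exact/val_inj.
  by rewrite (_ : Ordinal j = 0); last exact/val_inj.
- rewrite (_ : Ordinal i = 1); last exact/val_inj.
  by rewrite (_ : Ordinal j = 1); [rewrite [X in P _ _ X]f11|exact/val_inj].
Qed.

Lemma continuous_SO2 (T : topologicalType) (f : T -> SO2 R) :
  continuous (fun x => cosSO2 (f x)) -> continuous (fun x => sinSO2 (f x)) ->
  continuous f.
Proof.
move=> fc fs x.
exact: (@cvg_SO2 T (nbhs x) (nbhs_filter x) f (f x) (fc x) (fs x)).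
Qed.

Lemma rotSO2_continuous : continuous (@rotSO2 R).
Proof.
apply: continuous_SO2.
  rewrite (_ : (fun x => _) = cos); first exact: continuous_cos.
  by apply/funext => x; rewrite cosSO2_rot.
rewrite (_ : (fun x => _) = sin); first exact: continuous_sin.
by apply/funext => x; rewrite sinSO2_rot.
Qed.

Lemma mulSO2_continuous g : continuous (mulSO2 g).
Proof.
have cc := cosSO2_continuous; have cs := sinSO2_continuous.
apply: continuous_SO2.
  rewrite (_ : (fun x => _) =
    (fun x => cosSO2 g * cosSO2 x - sinSO2 g * sinSO2 x)); last first.
    by apply/funext => x; rewrite cosSO2M.
  by apply: contB; apply: contM => //; exact: cont_cst.
rewrite (_ : (fun x => _) =
  (fun x => sinSO2 g * cosSO2 x + cosSO2 g * sinSO2 x)); last first.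
  by apply/funext => x; rewrite sinSO2M.
by apply: contD; apply: contM => //; exact: cont_cst.
Qed.

Lemma SO2_compact : compact [set: SO2 R].
Proof.
have -> : [set: SO2 R] = rotSO2 @` `[- pi, pi].
  apply/esym; rewrite -subTset => g _.
  by have [t [tpi ->]] := rotSO2_surj g; exists t => //=; rewrite in_itv.
apply: continuous_compact; last exact: segment_compact.
by apply: continuous_subspaceT; exact: rotSO2_continuous.
Qed.

(** Near [rotSO2 t] an angle is recovered continuously as [t] plus an arcsine.
    Through these local inverses of the covering map, continuity on SO(2) can be
    read off in angular coordinates. *)
Lemma rotSO2_section t : exists s : SO2 R -> R,
  s h @[h --> rotSO2 t] --> t /\
  \forall h \near rotSO2 t, rotSO2 (s h) = h.
Proof.
pose r h := mulSO2 (rotSO2 (- t)) h.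
have rc : continuous r by exact: mulSO2_continuous.
have r1 : r (rotSO2 t) = oneSO2 by rewrite /r -rotSO2D addNr rotSO20.
have s0 : sinSO2 (r (rotSO2 t)) = 0 by rewrite r1 -rotSO20 sinSO2_rot sin0.
have a0 : asin 0 = 0 :> R.
  rewrite -[X in asin X]sin0 sinK// in_itv/=.
  by rewrite oppr_le0 andbb divr_ge0// pi_ge0.
have src := cont_comp rc sinSO2_continuous.
exists (fun h => t + asin (sinSO2 (r h))); split.
  have ac : {for sinSO2 (r (rotSO2 t)), continuous (@asin R)}.
    by apply: continuous_asin; rewrite s0 ltrN10 ltr01.
  have tE : t = t + asin (sinSO2 (r (rotSO2 t))) by rewrite s0 a0 addr0.
  rewrite [X in _ --> X]tE.
  exact: (continuousD (@cst_continuous _ _ t (rotSO2 t))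
    (continuous_comp (src (rotSO2 t)) ac)).
have : \forall h \near rotSO2 t, 0 < cosSO2 (r h).
  have c0 : 0 < cosSO2 (r (rotSO2 t)) by rewrite r1 cosSO2_1.
  have crc := cont_comp rc cosSO2_continuous.
  have := crc (rotSO2 t) _ (lt_nbhsr c0); exact.
apply: filterS => h c0.
have [u [_ ru]] := rotSO2_surj (r h).
have hE : h = mulSO2 (rotSO2 t) (r h).
  by rewrite /r mulSO2A -rotSO2D subrr rotSO20 mulSO2C mulSO21.
have s1 : -1 <= sinSO2 (r h) <= 1 by rewrite ru sinSO2_rot sin_geN1 sin_le1.
rewrite rotSO2D [RHS]hE; congr mulSO2; apply: SO2_inj.
  rewrite cosSO2_rot cos_asin//.
  have := cosSO2D1 (r h) => /(canRL (addrK _)) <-.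
  by rewrite sqrtr_sqr gtr0_norm.
by rewrite sinSO2_rot asinK// in_itv.
Qed.

Lemma continuous_of_rot (T : topologicalType) (f : SO2 R -> T) :
  continuous (f \o rotSO2) -> continuous f.
Proof.
move=> fc g; have [t [_ ->]] := rotSO2_surj g.
have [s [st rs]] := rotSO2_section t.
have : f (rotSO2 (s h)) @[h --> rotSO2 t] --> f (rotSO2 t).
  exact: (cvg_comp _ _ st (fc t)).
apply: (cvg_near_eq (f := fun h => f (rotSO2 (s h)))).
have rs_f (h : SO2 R) : rotSO2 (s h) = h -> f (rotSO2 (s h)) = f h by move=> ->.
exact: filterS rs_f rs.
Qed.

Lemma continuous2_of_rot (T : topologicalType) (k : SO2 R -> SO2 R -> T) :
  continuous (fun u : R * R => k (rotSO2 u.1) (rotSO2 u.2)) ->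
  continuous (fun u : SO2 R * SO2 R => k u.1 u.2).
Proof.
move=> kc [g h]; have [t [_ ->]] := rotSO2_surj g.
have [u [_ ->]] := rotSO2_surj h.
have [s [st rs]] := rotSO2_section t.
have [s' [su rs']] := rotSO2_section u.
have : k (rotSO2 (s z.1)) (rotSO2 (s' z.2)) @[z --> (rotSO2 t, rotSO2 u)]
    --> k (rotSO2 t) (rotSO2 u).
  apply: (@cvg_comp _ _ _ (fun z => (s z.1, s' z.2))
    (fun u => k (rotSO2 u.1) (rotSO2 u.2))); last exact: (kc (t, u)).
  exact: cvg_pair_map.
apply: (cvg_near_eq (f := fun z => k (rotSO2 (s z.1)) (rotSO2 (s' z.2)))).
exists ([set h | rotSO2 (s h) = h], [set h | rotSO2 (s' h) = h]) => //=.
by move=> [a b] [/= -> ->].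
Qed.

End circle_group.

(** * Integration against Haar measure *)
Section compact_extrema.
Context {R : realType} {T : topologicalType} (x0 : T).
Hypothesis cT : compact [set: T].

Lemma compact_bound (f : T -> R) : continuous f ->
  exists2 M : R, 0 < M & forall x, `|f x| <= M.
Proof.
move=> fc.
have nc : continuous (fun x => `|f x|).
  by move=> x; exact: (continuous_comp (fc x) (@norm_continuous _ _ (f x))).
have [|c _ cmax] := compact_EVT_max _ cT (continuous_subspaceT nc).
  by exists x0.
exists (`|f c| + 1); first by rewrite ltr_wpDl.
move=> x; rewrite (@le_trans _ _ `|f c|)//; last by rewrite lerDl.
by apply: cmax; exact/mem_set.
Qed.

Lemma compact_pos_bound (f : T -> R) : continuous f -> (forall x, 0 < f x) ->
  exists2 c : R, 0 < c & forall x, c <= f x.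
Proof.
move=> fc f0.
have [|c _ cmin] := compact_EVT_min _ cT (continuous_subspaceT fc).
  by exists x0.
by exists (f c) => // x; apply: cmin; exact/mem_set.
Qed.

End compact_extrema.

Section haar_integral.
Context {R : realType} (mu : probability (SO2 R) R).
Implicit Types (g h : SO2 R) (f : SO2 R -> R) (k : SO2 R -> SO2 R -> R).

Lemma SO2_bound f : continuous f -> exists2 M : R, 0 < M & forall g, `|f g| <= M.
Proof. exact: (compact_bound oneSO2 SO2_compact). Qed.

Lemma SO2X_compact : compact [set: SO2 R * SO2 R].
Proof. by rewrite -setXTT; exact: compact_setX SO2_compact SO2_compact. Qed.

Lemma open_measurable_SO2 (A : set (SO2 R)) : open A -> measurable A.
Proof. by move=> oA; exact: sub_sigma_algebra. Qed.

Lemma continuous_measurable_SO2 f : continuous f -> measurable_fun setT f.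
Proof.
move=> /continuousP fc; apply: (measurability _ (RGenOInfty.measurableE R)).
move=> _ [_ [x ->] <-]; rewrite setTI; apply: open_measurable_SO2.
exact/fc/rray_open.
Qed.

Lemma mulSO2_measurable g : measurable_fun setT (mulSO2 g).
Proof.
have /continuousP mc := @mulSO2_continuous R g.
apply: (measurability (@open (SO2 R))) => // _ [A oA <-].
by rewrite setTI; apply: open_measurable_SO2; exact: mc.
Qed.

Lemma bounded_integrable_SO2 f M : measurable_fun setT f ->
  (forall g, `|f g| <= M) -> mu.-integrable setT (EFin \o f).
Proof.
move=> fm fM; apply: measurable_bounded_integrable => //.
  by rewrite [ltLHS]probability_setT ltry.
exists M; split; first by rewrite num_real.
by move=> N MN x _; exact: le_trans (fM x) (ltW MN).
Qed.

Lemma continuous_integrable_SO2 f : continuous f ->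
  mu.-integrable setT (EFin \o f).
Proof.
move=> fc; have [M _ fM] := SO2_bound fc.
exact: (bounded_integrable_SO2 (continuous_measurable_SO2 fc) fM).
Qed.

Lemma Rintegral_const (a : R) : \int[mu]_g a = a.
Proof.
rewrite Rintegral_cst// -[RHS]mulr1; congr (_ * _).
exact: (congr1 fine (@probability_setT _ _ _ mu)).
Qed.

Lemma le_Rintegral_cont f1 f2 : continuous f1 -> continuous f2 ->
  (forall g, f1 g <= f2 g) -> \int[mu]_g f1 g <= \int[mu]_g f2 g.
Proof.
by move=> c1 c2 f12; apply: le_Rintegral => //; exact: continuous_integrable_SO2.
Qed.

Lemma Rintegral_gt0 f : continuous f -> (forall g, 0 < f g) ->
  0 < \int[mu]_g f g.
Proof.
move=> fc f0; have [c c0 cf] := compact_pos_bound oneSO2 SO2_compact fc f0.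
apply: (lt_le_trans c0); rewrite -[leLHS]Rintegral_const.
by apply: le_Rintegral_cont => //; exact: cont_cst.
Qed.

Section invariance.
Hypothesis hmu : is_haar mu.

Lemma haar_Rintegral g f : continuous f ->
  \int[mu]_h f (mulSO2 g h) = \int[mu]_h f h.
Proof.
move=> fc; rewrite /Rintegral; congr fine.
have mg := mulSO2_measurable g.
transitivity (\int[pushforward mu (mulSO2 g)]_h (f h)%:E)%E.
  rewrite (@integral_pushforward _ _ _ _ _ _ mg mu setT (EFin \o f)) //.
    by apply/measurable_EFinP; exact: continuous_measurable_SO2.
  apply: (@continuous_integrable_SO2 (f \o mulSO2 g)).
  exact: (cont_comp (@mulSO2_continuous R g) fc).
by apply: eq_measure_integral => A mA _; exact: hmu.
Qed.

(** Finitely many translates of [U] cover the compact group, and they all have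
    the measure of [U]. *)
Lemma haar_open_gt0 (U : set (SO2 R)) : open U -> U !=set0 -> (0 < mu U)%E.
Proof.
move=> oU [u Uu]; rewrite lt0e measure_ge0 andbT; apply/eqP => U0.
have := SO2_compact (R := R); rewrite compact_cover => cov.
have [||D _ DT] := cov (SO2 R) setT (fun g => mulSO2 g @^-1` U).
- by move=> g _; have /continuousP := @mulSO2_continuous R g; exact.
- move=> x _; have [t [_ xt]] := rotSO2_surj x.
  exists (mulSO2 u (rotSO2 (- t))) => //=.
  by rewrite -mulSO2A xt -rotSO2D addNr rotSO20 mulSO21.
have aeF : {ae mu, forall x, (\bigcap_(g in [set` D]) ~` (mulSO2 g @^-1` U)) x}.
  apply: filter_bigI => g _.
  rewrite /nbhs/= /almost_everywhere setCK.
  exists (mulSO2 g @^-1` U); split => //.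
    apply: open_measurable_SO2.
    by have /continuousP := @mulSO2_continuous R g; exact.
  by rewrite [LHS]hmu//; exact: open_measurable_SO2.
have := aeF; rewrite /prop_near1 /nbhs /= /almost_everywhere.
rewrite (_ : ~` _ = setT); last first.
  rewrite -subTset => x _ /= xD; have [g gD gx] := DT x I.
  exact: (xD g gD).
move/(measure_negligible measurableT).
by move/(etrans (esym (@probability_setT _ _ _ mu)))/eqP; rewrite onee_eq0.
Qed.

Lemma continuous_ae_eq f1 f2 : continuous f1 -> continuous f2 ->
  f1 = f2 %[ae mu] -> f1 =1 f2.
Proof.
move=> c1 c2 [A [mA A0 fA]] x; apply/eqP/negPn/negP => fx.
pose U := [set x | f1 x - f2 x != 0].
have oU : open U.
  have /continuousP oc := contB c1 c2.
  exact: (oc [set y | y != 0] (@open_neq R 0)).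
have : (0 < mu U)%E.
  by apply: haar_open_gt0 => //; exists x; rewrite /U/= subr_eq0.
rewrite ltNge => /negP; apply; rewrite -A0; apply: le_measure.
- by rewrite inE; exact: open_measurable_SO2.
- by rewrite inE.
- move=> y /= fy; apply: fA => /= /(_ I) fE; move: fy.
  by rewrite /U/= fE subrr eqxx.
Qed.

End invariance.

Lemma kernel_op_continuous k f :
  continuous (fun u : SO2 R * SO2 R => k u.1 u.2) -> continuous f ->
  continuous (kernel_op mu k f).
Proof.
move=> kc fc.
have [M M0 kM] := compact_bound (oneSO2, oneSO2) SO2X_compact kc.
have [N N0 fN] := SO2_bound fc.
apply: continuous_of_rot => a.
have kxc x : continuous (k x) := cont_comp (@pair_continuousr _ _ x) kc.
have kyc y : continuous (k ^~ y) := cont_comp (@pair_continuousl _ _ y) kc.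
have kfc x : continuous (fun h => k x h * f h) by exact: contM.
apply: (@continuity_under_integral R _ (SO2 R) mu
  (fun t h => k (rotSO2 t) h * f h) setT measurableT (a - 1) (a + 1)
  _ _ (fun _ => M * N)).
- by move=> t _; exact: continuous_integrable_SO2.
- apply: aeW => y _ t _.
  apply: (@contM R R (fun t => k (rotSO2 t) y) (fun _ => f y)).
    exact: (cont_comp (@rotSO2_continuous R) (kyc y)).
  exact: cont_cst.
- by apply: continuous_integrable_SO2; exact: cont_cst.
- move=> t _; apply: aeW => y _; rewrite normrM ler_pM//.
  exact: (kM (rotSO2 t, y)).
- by rewrite inE /= in_itv/=; apply/andP; split; lra.
Qed.

(** Needed for Fubini: the product sigma-algebra contains the open sets because
    SO(2), a compact metric space, is second countable. *)
Lemma open_measurable_SO2X (W : set (SO2 R * SO2 R)) : open W -> measurable W.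
Proof.
move=> oW; have [B cB [Bo Bn]] := compact_second_countable (@SO2_compact R).
pose D := [set p : set (SO2 R) * set (SO2 R) |
  [/\ B p.1, B p.2 & p.1 `*` p.2 `<=` W]].
have -> : W = \bigcup_(p in D) (p.1 `*` p.2).
  apply/seteqP; split; last by move=> z [p [_ _ pW]]; exact: pW.
  move=> [x y] Wxy.
  have [[P Q] /= [nP nQ] PQW] : nbhs (x, y) W by exact: open_nbhs_nbhs.
  have [P' [BP' P'x] P'P] := Bn x _ nP.
  have [Q' [BQ' Q'y] Q'Q] := Bn y _ nQ.
  exists (P', Q') => //; split => //= -[x' y'] [/= /P'P ? /Q'Q ?].
  exact: PQW.
have cD : countable D.
  apply: (@sub_countable _ _ _ (B `*` B)); last exact: countableX.
  by apply: subset_card_le => p [].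
rewrite bigcup_set_type; apply: countable_bigcupT_measurable.
  by rewrite (eq_countable (card_setT _)).
move=> [p /= /set_mem[/Bo Bp1 /Bo Bp2 _]].
by apply: measurableX; exact: open_measurable_SO2.
Qed.

Lemma continuous_measurable_SO2X (F : SO2 R * SO2 R -> R) : continuous F ->
  measurable_fun setT F.
Proof.
move=> /continuousP fc; apply: (measurability _ (RGenOInfty.measurableE R)).
move=> _ [_ [x ->] <-]; rewrite setTI; apply: open_measurable_SO2X.
exact/fc/rray_open.
Qed.

Lemma EFin_Rintegral_SO2 f : continuous f ->
  (\int[mu]_g f g)%:E = (\int[mu]_g (f g)%:E)%E.
Proof.
by move=> fc; rewrite fineK//; apply: integrable_fin_num => //;
  exact: continuous_integrable_SO2.
Qed.

Lemma kernel_op_fubini k f1 f2 :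
  continuous (fun u : SO2 R * SO2 R => k u.1 u.2) ->
  continuous f1 -> continuous f2 -> (forall g h, 0 < k g h) ->
  (forall g, 0 < f1 g) -> (forall g, 0 < f2 g) ->
  \int[mu]_g (f1 g * kernel_op mu k f2 g) =
  \int[mu]_g (f2 g * kernel_op mu (fun g h => k h g) f1 g).
Proof.
move=> kc c1 c2 k0 f10 f20.
pose F (u : SO2 R * SO2 R) := (f1 u.1 * (k u.1 u.2 * f2 u.2))%:E.
have Fc : continuous (fun u : SO2 R * SO2 R => f1 u.1 * (k u.1 u.2 * f2 u.2)).
  apply: contM; first exact: (cont_comp (@fst_continuous _ _) c1).
  by apply: contM => //; exact: (cont_comp (@snd_continuous _ _) c2).
have Fm : measurable_fun setT F.
  by apply/measurable_EFinP; exact: continuous_measurable_SO2X.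
have F0 u : (0 <= F u)%E.
  by rewrite lee_fin !mulr_ge0 // ltW.
have kxc x : continuous (k x) := cont_comp (@pair_continuousr _ _ x) kc.
have kyc y : continuous (k ^~ y) := cont_comp (@pair_continuousl _ _ y) kc.
have := @fubini_tonelli _ _ _ _ R mu mu F Fm F0.
rewrite /Rintegral => FE; congr fine.
transitivity (\int[mu]_x \int[mu]_y F (x, y))%E.
  apply: eq_integral => x _; rewrite /kernel_op -RintegralZl//; last first.
    by apply: continuous_integrable_SO2; exact: contM.
  by rewrite EFin_Rintegral_SO2//; apply: contM; [exact: cont_cst|exact: contM].
rewrite FE; apply: eq_integral => y _; rewrite /kernel_op -RintegralZl//; last first.
  by apply: continuous_integrable_SO2; exact: contM.
rewrite EFin_Rintegral_SO2//; last first.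
  by apply: contM; [exact: cont_cst|exact: contM].
by apply: eq_integral => x _; rewrite /F/=; congr EFin; ring.
Qed.

End haar_integral.

(** * Trigonometric eigenfunctions of the Laplacian *)
Section real_derivatives.
Context {R : realType}.
Implicit Types f : R -> R.

Lemma derivable_dir f x v : derivable f x 1 -> derivable f x v.
Proof. by move/derivable1_diffP => fd; exact: diff_derivable. Qed.

Lemma derive_dir f x v : derivable f x 1 -> 'D_v f x = v * derive1 f x.
Proof. by move/derivable1_diffP => fd; rewrite deriveE// diff1E. Qed.

Lemma derive_valE f x v df : is_derive x v f df -> 'D_v f x = df.
Proof. by case. Qed.

Lemma is_derive_cos_affine (a b c x : R) :
  is_derive x 1 (fun t : R => a * cos (b * t + c))
    (a * b * cos (b * x + (c + pi / 2))).
Proof.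
apply: is_derive_eq; rewrite addrA cosDpihalf.
by rewrite /GRing.scale/=; ring.
Qed.

Lemma is_Cn_cos_affine n (a b c : R) :
  is_Cn n (fun t : R => a * cos (b * t + c)).
Proof.
elim: n a c => [|n IH] a c /=; split => //.
- move=> x; apply: differentiable_continuous; apply/derivable1_diffP.
  by have [] := is_derive_cos_affine a b c x.
- move=> x; apply: differentiable_continuous; apply/derivable1_diffP.
  by have [] := is_derive_cos_affine a b c x.
- move=> v; have fd x : derivable (fun t : R => a * cos (b * t + c)) x 1.
    by have [] := is_derive_cos_affine a b c x.
  split=> [x|]; first exact: derivable_dir.
  rewrite (_ : (fun x => _) =
    (fun x => (v * (a * b)) * cos (b * x + (c + pi / 2)))); first exact: IH.
  apply/funext => x; rewrite derive_dir// derive1E.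
  by rewrite (derive_valE (is_derive_cos_affine a b c x)) !mulrA.
Qed.

End real_derivatives.

Section invariant_derivative.
Context {R : realType}.
Implicit Types (f : SO2 R -> R) (g : SO2 R) (s t : R).

Definition angular_derive f g : R :=
  derive1 (fun s : R => f (mulSO2 g (rotSO2 s))) 0.

Definition angular_derivable f :=
  forall t : R, derivable (fun t => f (rotSO2 t)) t 1.

Lemma angular_derive_rot f t :
  angular_derive f (rotSO2 t) = derive1 (fun t => f (rotSO2 t)) t.
Proof.
pose G s := f (mulSO2 (rotSO2 t) (rotSO2 s)).
pose F s := f (rotSO2 s).
have GF : (fun h : R => h^-1 *: (G (h + 0) - G 0)) =
    (fun h : R => h^-1 *: (F (h + t) - F t)).
  by apply/funext => h; rewrite /G /F -!rotSO2D !addr0 [t + h]addrC.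
by rewrite /angular_derive /derive1 -/G -/F GF.
Qed.

Lemma is_derive_rot f t : angular_derivable f ->
  is_derive t 1 (fun t => f (rotSO2 t)) (angular_derive f (rotSO2 t)).
Proof.
move=> fd; rewrite angular_derive_rot derive1E; exact: (derivableP (fd t)).
Qed.

Lemma is_derive_mulSO2 f g s : angular_derivable f ->
  is_derive s 1 (fun s : R => f (mulSO2 g (rotSO2 s)))
    (angular_derive f (mulSO2 g (rotSO2 s))).
Proof.
move=> fd; have [t [_ ->]] := rotSO2_surj g.
rewrite (_ : (fun s => _) = (fun t => f (rotSO2 t)) \o (fun s => t + s)).
  rewrite -rotSO2D.
  have fts := is_derive_rot (t + s) fd.
  have ts : is_derive s 1 (fun s : R => t + s) 1.
    have := is_deriveD (is_derive_cst t s 1) (is_derive_id s 1).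
    by rewrite add0r.
  by have := is_derive1_comp fts ts; rewrite mulr1.
by apply/funext => u /=; rewrite rotSO2D.
Qed.

Lemma angular_derivable_continuous f : angular_derivable f -> continuous f.
Proof.
move=> fd; apply: continuous_of_rot => t.
exact/differentiable_continuous/derivable1_diffP/fd.
Qed.

Lemma smooth_derivable f : smooth f -> angular_derivable f.
Proof. by move=> /(_ 1%N)[_ /(_ 1)[fd _]] t; exact: fd. Qed.

Lemma smooth_continuous f : smooth f -> continuous f.
Proof. by move=> /smooth_derivable; exact: angular_derivable_continuous. Qed.

Lemma smooth_derive_continuous f : smooth f -> continuous (angular_derive f).
Proof.
move=> /(_ 1%N)[_ /(_ 1)[fd [fc _]]]; apply: continuous_of_rot.
rewrite (_ : _ \o _ = (fun x => 'D_1 (fun t => f (rotSO2 t)) x)) //.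
by apply/funext => t /=; rewrite angular_derive_rot derive1E.
Qed.

Lemma dSO2E f g X : angular_derivable f ->
  dSO2 f g X = X 1 0 * angular_derive f g.
Proof.
move=> fd; rewrite /dSO2 /expSO2.
rewrite (_ : (fun s => _) =
  (fun s => f (mulSO2 g (rotSO2 s))) \o (fun s => s * X 1 0)); last first.
  by apply/funext => s /=; rewrite !mxE.
have Xs : is_derive (0 : R) 1 (fun s : R => s * X 1 0) (X 1 0).
  by apply: is_derive_eq; rewrite /GRing.scale/=; ring.
have fs := is_derive_mulSO2 g (0 * X 1 0) fd.
rewrite derive1E.
rewrite (derive_valE (is_derive1_comp (g := fun s : R => s * X 1 0) fs Xs)).
by rewrite mul0r rotSO20 mulSO21 mulrC.
Qed.

Lemma angular_derivableM f1 f2 : angular_derivable f1 -> angular_derivable f2 ->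
  angular_derivable (fun g => f1 g * f2 g).
Proof. by move=> d1 d2 t; exact: derivableM. Qed.

Lemma angular_deriveM f1 f2 g : angular_derivable f1 -> angular_derivable f2 ->
  angular_derive (fun g => f1 g * f2 g) g =
  f1 g * angular_derive f2 g + f2 g * angular_derive f1 g.
Proof.
move=> d1 d2; have [t [_ ->]] := rotSO2_surj g.
have i1 := is_derive_rot t d1; have i2 := is_derive_rot t d2.
rewrite angular_derive_rot derive1E.
by rewrite (derive_valE (is_deriveM i1 i2)).
Qed.

Section integration_by_parts.
Variable mu : probability (SO2 R) R.
Hypothesis hmu : is_haar mu.

(** The integral of [f (g * rotSO2 x)] over [g] does not depend on [x];
    differentiate under the integral sign at [x = 0]. *)
Lemma Rintegral_angular_derive f : angular_derivable f ->
  continuous (angular_derive f) -> \int[mu]_g angular_derive f g = 0.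
Proof.
move=> fd dc; have fc := angular_derivable_continuous fd.
have [M M0 dM] := SO2_bound dc.
pose F (x : R) (g : SO2 R) := f (mulSO2 g (rotSO2 x)).
have FE x : F x = (fun g => f (mulSO2 (rotSO2 x) g)).
  by apply/funext => g; rewrite /F mulSO2C.
have pE x g : partial1of2 F x g = angular_derive f (mulSO2 g (rotSO2 x)).
  by rewrite partial1of2E; rewrite (derive_valE (is_derive_mulSO2 g x fd)).
have Fint : (fun x => \int[mu]_g F x g) = (fun _ => \int[mu]_g f g).
  apply/funext => x; rewrite -(haar_Rintegral hmu (rotSO2 x) fc).
  by apply: eq_Rintegral => g _; rewrite /F mulSO2C.
have H : derive1 (fun x => \int[mu]_g F x g) 0 = \int[mu]_g partial1of2 F 0 g.
  apply: (@differentiation_under_integral R _ (SO2 R) mu F setT measurableT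
    0 (-1) 1 _ _ _ (fun _ => M)).
  - by rewrite /= in_itv/=; apply/andP; split; lra.
  - move=> x _; apply: continuous_integrable_SO2; rewrite FE.
    exact: cont_comp (@mulSO2_continuous R (rotSO2 x)) fc.
  - by move=> x g _ _; have [] := is_derive_mulSO2 g x fd.
  - by move=> _; exact: ltW.
  - by apply: continuous_integrable_SO2; exact: cont_cst.
  - by move=> x g _ _; rewrite pE.
move: H; rewrite Fint derive1_cst => ->.
by apply: eq_Rintegral => g _; rewrite pE rotSO20 mulSO21.
Qed.

End integration_by_parts.

End invariant_derivative.

Section trigonometric_functions.
Context {R : realType}.
Implicit Types (g h : SO2 R).

Definition powSO2 g n : SO2 R := iter n (mulSO2 g) oneSO2.

Lemma powSO2_rot (t : R) n : powSO2 (rotSO2 t) n = rotSO2 (n%:R * t).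
Proof.
elim: n => [|n IH]; first by rewrite mul0r rotSO20.
by rewrite /powSO2 iterS -/(powSO2 _ _) IH -rotSO2D -natr1 mulrDl mul1r addrC.
Qed.

(** This is [t |-> cos (n t + c)], written with powers in the group so that no
    choice of an angle is involved. *)
Definition trigSO2 n (c : R) g : R := cosSO2 (mulSO2 (powSO2 g n) (rotSO2 c)).

Lemma trigSO2_rot n c (t : R) : trigSO2 n c (rotSO2 t) = cos (n%:R * t + c).
Proof. by rewrite /trigSO2 powSO2_rot -rotSO2D cosSO2_rot. Qed.

Lemma trigSO2_rotE n c a :
  (fun t : R => a * trigSO2 n c (rotSO2 t)) = (fun t => a * cos (n%:R * t + c)).
Proof. by apply/funext => t; rewrite trigSO2_rot. Qed.

Lemma smooth_trigSO2 n c a : smooth (fun g => a * trigSO2 n c g).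
Proof. by move=> m; rewrite trigSO2_rotE; exact: is_Cn_cos_affine. Qed.

Lemma angular_derive_trigSO2 n c a g :
  angular_derive (fun g => a * trigSO2 n c g) g =
  a * n%:R * trigSO2 n (c + pi / 2) g.
Proof.
have [t [_ ->]] := rotSO2_surj g.
rewrite angular_derive_rot trigSO2_rotE trigSO2_rot derive1E.
by rewrite (derive_valE (is_derive_cos_affine a n%:R c t)).
Qed.

Definition J_mx : 'M[R]_2 :=
  \matrix_(i < 2, j < 2)
    (((i == 1) && (j == 0))%:R - ((i == 0) && (j == 1))%:R).

Lemma J_so2 : so2 J_mx.
Proof.
apply/matrixP => i j; rewrite !mxE.
by rewrite opprB (andbC (j == 1)) (andbC (j == 0)).
Qed.

Lemma so2E (X : 'M[R]_2) : so2 X -> X = X 1 0 *: J_mx.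
Proof.
move=> /matrixP sX.
have X00 : X 0 0 = 0 by have := sX 0 0; rewrite !mxE; lra.
have X11 : X 1 1 = 0 by have := sX 1 1; rewrite !mxE; lra.
have X01 : X 0 1 = - X 1 0 by have := sX 1 0; rewrite !mxE.
apply/matrixP => i j; rewrite !mxE.
case: i => [[|[|//]] i]; case: j => [[|[|//]] j] /=.
- by rewrite subrr mulr0 -X00; congr (X _ _); exact/val_inj.
- rewrite sub0r mulrN1 -X01; congr (X _ _); exact/val_inj.
- rewrite subr0 mulr1; congr (X _ _); exact/val_inj.
- by rewrite subrr mulr0 -X11; congr (X _ _); exact/val_inj.
Qed.

Lemma so2Z (a : R) (X : 'M[R]_2) : so2 X -> so2 (a *: X).
Proof. by rewrite /so2 /= => sX; rewrite linearZ/= sX scalerN. Qed.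

Variables (ip : 'M[R]_2 -> 'M[R]_2 -> R) (mu : probability (SO2 R) R).
Hypotheses (hip : Ad_invariant_inner_product ip) (hmu : is_haar mu).

Lemma ipJ_gt0 : 0 < ip J_mx J_mx.
Proof.
apply: (ip_pos hip J_so2); apply/eqP => /matrixP/(_ 1 0); rewrite !mxE/=.
by rewrite subr0 => /eqP; rewrite oner_eq0.
Qed.

Lemma ipJ a b : ip (a *: J_mx) (b *: J_mx) = a * b * ip J_mx J_mx.
Proof.
have s0 : so2 (0 : 'M[R]_2) by rewrite /so2/= trmx0 oppr0.
have ip0 Z : so2 Z -> ip 0 Z = 0.
  move=> sZ; have := ip_linear hip 1 s0 s0 sZ.
  by rewrite scaler0 addr0 mul1r => H; apply: (addIr (ip 0 Z)); rewrite -H add0r.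
have ipZ c X Z : so2 X -> so2 Z -> ip (c *: X) Z = c * ip X Z.
  move=> sX sZ; have := ip_linear hip c sX s0 sZ.
  by rewrite addr0 (ip0 _ sZ) addr0.
have sJ := J_so2; have sbJ := so2Z b sJ.
by rewrite (ipZ _ _ _ sJ sbJ) (ip_sym hip sJ sbJ) (ipZ _ _ _ sJ sJ) mulrA.
Qed.

(** The gradient is [v J] with [v = f' / ip J J], and the divergence of [v J] is
    [v'], because the integral of [(v h)'] vanishes. *)
Lemma trigSO2_laplacian n c :
  is_laplacian ip mu (trigSO2 n c)
    (fun g => - (n%:R ^+ 2 / ip J_mx J_mx) * trigSO2 n c g).
Proof.
have J0 := ipJ_gt0.
have fE : trigSO2 n c = (fun g => 1 * trigSO2 n c g).
  by apply/funext => g; rewrite mul1r.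
have fs : smooth (trigSO2 n c) by rewrite fE; exact: smooth_trigSO2.
have fd := smooth_derivable fs.
pose q := n%:R / ip J_mx J_mx.
pose v g := q * trigSO2 n (c + pi / 2) g.
have vs : smooth v by exact: smooth_trigSO2.
have vd := smooth_derivable vs.
have vE g : v g * ip J_mx J_mx = angular_derive (trigSO2 n c) g.
  rewrite fE angular_derive_trigSO2 mul1r /v /q.
  by rewrite mulrAC divfK// gt_eqF.
have v'E g : angular_derive v g = - (n%:R ^+ 2 / ip J_mx J_mx) * trigSO2 n c g.
  rewrite angular_derive_trigSO2 /q.
  have [t [_ ->]] := rotSO2_surj g; rewrite !trigSO2_rot.
  by rewrite !addrA cosDpihalf sinDpihalf; ring.
split=> //; exists (fun g => v g *: J_mx); split.
  move=> g; split; first exact: so2Z J_so2.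
  move=> X sX; rewrite dSO2E// [in LHS](so2E sX) ipJ -vE; ring.
split; first exact: smooth_trigSO2.
move=> h hs; have hd := smooth_derivable hs.
have hc := smooth_continuous hs; have h'c := smooth_derive_continuous hs.
have vc := smooth_continuous vs; have v'c := smooth_derive_continuous vs.
have vh : \int[mu]_g (v g * angular_derive h g + h g * angular_derive v g) = 0.
  rewrite -(Rintegral_angular_derive hmu (angular_derivableM vd hd)).
    by apply: eq_Rintegral => g _; rewrite angular_deriveM.
  rewrite (_ : angular_derive _ =
    (fun g => v g * angular_derive h g + h g * angular_derive v g)).
    by apply: contD; exact: contM.
  by apply/funext => g; rewrite angular_deriveM.
move: vh; rewrite RintegralD//; try (by apply: continuous_integrable_SO2; exact: contM).
move=> /eqP; rewrite addrC addr_eq0 => /eqP vh.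
transitivity (\int[mu]_g (h g * angular_derive v g)).
  by apply: eq_Rintegral => g _; rewrite v'E mulrC.
rewrite vh; congr (- _); apply: eq_Rintegral => g _.
by rewrite dSO2E// !mxE/= subr0 mulr1.
Qed.

End trigonometric_functions.

(** * Eigenvectors of a strongly continuous semigroup *)

(** [N] is a seminorm for which the laws of a strongly continuous semigroup hold
    up to null vectors, as they do in L^2 when functions are not identified
    almost everywhere.  [T_generator] says that [x] is in the domain of the
    generator, with eigenvalue [- l]. *)
Section semigroup_eigenvector.
Context {R : realType} {X : lmodType R}.
Implicit Types (a b c d e h s t u K : R) (y z w : X).
Variables (N : X -> R) (T : R -> X -> X) (l : R) (x : X).
Hypothesis ND : forall y z, N (y + z) <= N y + N z.
Hypothesis NZ : forall a y, N (a *: y) = `|a| * N y.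
Hypothesis T_linear : forall t, 0 <= t <= 1 -> forall a y z,
  N (T t (a *: y + z) - (a *: T t y + T t z)) = 0.
Hypothesis T_bounded : forall t, 0 <= t <= 1 ->
  exists C : R, forall y, N (T t y) <= C * N y.
Hypothesis T_add : forall s t, 0 <= s -> 0 <= t -> s + t <= 1 ->
  forall y, N (T (s + t) y - T s (T t y)) = 0.
Hypothesis T_continuous : forall y e, 0 < e -> exists2 d, 0 < d &
  forall t, 0 < t < d -> N (T t y - y) < e.
Hypothesis T_generator : forall e, 0 < e -> exists2 d, 0 < d &
  forall t, 0 < t < d -> N (T t x - x + (l * t) *: x) <= e * t.

Let N_opp y : N (- y) = N y.
Proof. by rewrite -scaleN1r NZ normrN1 mul1r. Qed.

Let N_0 : N 0 = 0.
Proof. by rewrite -(scale0r (0 : X)) NZ normr0 mul0r. Qed.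

Let N_ge0 y : 0 <= N y.
Proof. by have := ND y (- y); rewrite subrr N_0 N_opp; lra. Qed.

Let N_sub y z w : N (y - w) <= N (y - z) + N (z - w).
Proof. by rewrite -[X in N X <= _](subrKA z); exact: ND. Qed.

Let N_subC y z : N (y - z) = N (z - y).
Proof. by rewrite -N_opp opprB. Qed.

Let N_le y z : N y <= N (y - z) + N z.
Proof. by rewrite -[X in N X <= _](subrK z); exact: ND. Qed.

Let T_lipschitz t : 0 <= t <= 1 ->
  exists2 C : R, 0 <= C & forall y z, N (T t y - T t z) <= C * N (y - z).
Proof.
move=> t01; have [C TC] := T_bounded t01; exists `|C| => // y z.
have := T_linear t01 (- 1) z y; rewrite !scaleN1r ![- _ + _]addrC => Tyz.
have := N_le (T t y - T t z) (T t (y - z)).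
rewrite [N (_ - T t (y - z))]N_subC Tyz add0r => H.
by apply: (le_trans H); apply: (le_trans (TC _)); exact: ler_wpM2r (ler_norm C).
Qed.

Let T_scale t a y : 0 <= t <= 1 -> N (T t (a *: y) - a *: T t y) = 0.
Proof.
move=> t01; have [C TC] := T_bounded t01.
have T0 : N (T t 0) = 0.
  by apply/eqP; rewrite eq_le N_ge0 andbT (le_trans (TC 0))// N_0 mulr0.
have := T_linear t01 a y 0; rewrite addr0 => H.
apply/eqP; rewrite eq_le N_ge0 andbT.
have := N_sub (T t (a *: y)) (a *: T t y + T t 0) (a *: T t y).
by rewrite H add0r [_ + T t 0]addrC addrK T0.
Qed.

(** [E k] is the set of times with operator norm at most [k].  Strong continuity
    at [0] makes its complement open to the right, so if no [E k] contains an
    interval inside [(0, e)], then the interiors of these complements are dense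
    there.  Baire's theorem would give a time outside every [E k], that is, an
    unbounded operator. *)
Lemma semigroup_locally_bounded e : 0 < e <= 1 -> exists a b K : R,
  [/\ 0 < a, a < b, b < e &
      forall t, a <= t < b -> forall y, N (T t y) <= K * N y].
Proof.
move=> /andP[e0 e1]; apply: contrapT => unb.
pose E k := [set t : R | forall y, N (T t y) <= k%:R * N y].
pose F (k : nat) := [set t : R | t < 0] `|` [set t | e < t] `|` (~` E k)°.
have dF : dense (\bigcap_k F k).
  apply: (@Baire R R) => k; split.
    apply: openU; last exact: open_interior.
    by apply: openU; [exact: open_lt|exact: open_gt].
  move=> V [z Vz] oV.
  have [z0|z0] := ltP z 0; first by exists z; split => //; left; left.
  have [ze|ze] := ltP e z; first by exists z; split => //; left; right.
  have /nbhs_ballP[r /= r0 rV] : nbhs z V by exact: open_nbhs_nbhs.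
  pose a := Num.max 0 (z - r); pose b := Num.min e (z + r).
  have ab : a < b.
    rewrite /a /b gt_max !lt_min; apply/andP; split; apply/andP; split; lra.
  have abV t : a < t -> t < b -> V t.
    rewrite /a /b gt_max lt_min => /andP[_ t1] /andP[_ t2]; apply: rV.
    by rewrite /ball/= ltr_distlC; apply/andP; split; lra.
  have a0 : 0 <= a by rewrite le_max lexx.
  have be : b <= e by rewrite ge_min lexx.
  have [t [y [at1 tb Ty]]] : exists t y,
      [/\ a < t, t < b & k%:R * N y < N (T t y)].
    apply: contrapT => H; apply: unb.
    exists ((2 * a + b) / 3), ((a + 2 * b) / 3), k%:R; split; try lra.
    move=> t /andP[t1 t2] y; rewrite leNgt; apply/negP => Ty.
    by apply: H; exists t, y; split => //; lra.
  have t01 : 0 <= t <= 1 by apply/andP; split; lra.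
  have [C C0 TC] := T_lipschitz t01.
  (* With [g] below, [C * g < N (T t y) - k N y]: a perturbation of [y] of size
     less than [g] leaves the bound violated. *)
  pose g := (N (T t y) - k%:R * N y) / (C + 1).
  have g0 : 0 < g by rewrite divr_gt0// ?subr_gt0//; lra.
  have [d d0 Td] := T_continuous y g0.
  pose m := Num.min (t + d) b.
  have tm : t < m by rewrite /m lt_min; apply/andP; split; lra.
  have md : m <= t + d by rewrite /m ge_min lexx.
  have mb : m <= b by rewrite /m ge_min lexx orbT.
  have nE s : t < s -> s < m -> ~ E k s.
    move=> ts sm /(_ y); apply/negP; rewrite -ltNge.
    have st0 : 0 < s - t < d by apply/andP; split; lra.
    have := Td _ st0 => Tst.
    have := @T_add t (s - t) _ _ _ y; rewrite [t + _]addrC subrK => Ts.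
    have {}Ts : N (T s y - T t (T (s - t) y)) = 0.
      by apply: Ts; [lra|case/andP: st0 => /ltW|lra].
    have h1 := N_le (T t y) (T s y).
    have h2 := N_sub (T t y) (T t (T (s - t) y)) (T s y).
    have h3 : N (T t y - T t (T (s - t) y)) <= C * N (T (s - t) y - y).
      by rewrite N_subC.
    rewrite [N (T t (T (s - t) y) - T s y)]N_subC Ts addr0 in h2.
    have gC : g * (C + 1) = N (T t y) - k%:R * N y.
      by rewrite /g divfK// gt_eqF//; lra.
    have h4 : C * N (T (s - t) y - y) <= C * g by apply: ler_wpM2l => //; exact: ltW.
    have gE : g * (C + 1) = C * g + g by ring.
    lra.
  exists ((t + m) / 2); split; first by apply: abV; lra.
  right; rewrite /interior /=; apply/nbhs_ballP; exists ((m - t) / 2) => /=.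
    lra.
  move=> s; rewrite /ball/= ltr_distlC => /andP[s1 s2]; apply: nE; lra.
have [t [/= tI tF]] : (`]0, e[%classic `&` \bigcap_k F k) !=set0.
  apply: dF; last exact: itv_open.
  by exists (e / 2); rewrite /= in_itv/=; apply/andP; split; lra.
move: tI; rewrite in_itv/= => /andP[t0 te].
have t01 : 0 <= t <= 1 by apply/andP; split; lra.
have [C TC] := T_bounded t01.
have Ck : C <= (Num.trunc C).+1%:R by apply: ltW; rewrite truncnS_gt.
have [[tn|tn]|] := tF (Num.trunc C).+1 I; [move: tn => /=; lra|move: tn => /=; lra|].
move=> /interior_subset; apply => y.
by apply: (le_trans (TC y)); exact: ler_wpM2r.
Qed.

Let expR_taylor u : `|u| <= 1 / 2 -> `|expR (- u) - 1 + u| <= 2 * u ^+ 2.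
Proof.
rewrite ler_norml => /andP[u1 u2].
have h1 := expR_ge1Dx (- u); have h2 := expR_ge1Dx u.
have h3 : expR (- u) * expR u = 1 by rewrite -expRD addNr expR0.
have h4 := expR_gt0 (- u).
rewrite ger0_norm; last lra.
have h5 : expR (- u) * (1 + u) <= 1 by rewrite -[leRHS]h3 ler_wpM2l// ltW.
have h6 : (expR (- u) - 1 + u) * (1 + u) <= u ^+ 2.
  rewrite (_ : _ * _ = expR (- u) * (1 + u) - 1 + u ^+ 2); last by ring.
  by lra.
have h7 : (expR (- u) - 1 + u) * (1 / 2) <= (expR (- u) - 1 + u) * (1 + u).
  by apply: ler_wpM2l; lra.
lra.
Qed.

(* This is [o(h)] because [x] is an eigenvector of the generator. *)
Let residual h := T h x - expR (- (l * h)) *: x.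

Let residual_small e : 0 < e -> exists2 d, 0 < d &
  forall h, 0 < h < d -> N (residual h) <= e * h.
Proof.
move=> e0; have e20 : 0 < e / 2 by lra.
have [d d0 Td] := T_generator e20.
pose A := 1 + `|l|; pose B := 1 + N x.
have A1 : 1 <= A by rewrite lerDl.
have B1 : 1 <= B by rewrite lerDl.
pose d' := e / (4 * A ^+ 2 * B).
have AB : 0 < 4 * A ^+ 2 * B.
  by rewrite mulr_gt0// ?mulr_gt0 ?exprn_gt0//; lra.
have d'0 : 0 < d' by rewrite divr_gt0.
exists (Num.min d (Num.min d' ((2 * A)^-1))).
  by rewrite !lt_min d0 d'0 invr_gt0; lra.
move=> h /andP[h0]; rewrite !lt_min => /and3P[hd hd' hA].
have lA : `|l| <= A by rewrite lerDr.
have Ah : A * h < 1 / 2.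
  have : A * h < A * (2 * A)^-1 by rewrite ltr_pM2l//; lra.
  by rewrite invfM mulrCA mulfV ?gt_eqF//; lra.
have lh : `|l * h| <= A * h by rewrite normrM (gtr0_norm h0) ler_wpM2r// ltW.
have lh2 : (l * h) ^+ 2 <= A ^+ 2 * h ^+ 2.
  by rewrite -exprMn -(real_normK (num_real (l * h))) lerXn2r// nnegrE mulr_ge0//; lra.
have hdd : 0 < h < d by rewrite h0.
have h1 := Td _ hdd.
have lh12 : `|l * h| <= 1 / 2 by lra.
have h2 := expR_taylor lh12.
have -> : residual h =
    (T h x - x + (l * h) *: x) - (expR (- (l * h)) - 1 + l * h) *: x.
  rewrite /residual scalerDl scalerBl scale1r opprD opprB.
  by rewrite addrACA subrr addr0 subrKA.
apply: (le_trans (ND _ _)); rewrite N_opp NZ.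
have h3 : `|expR (- (l * h)) - 1 + l * h| * N x <= 2 * (A ^+ 2 * h ^+ 2) * B.
  apply: ler_pM => //; last by rewrite lerDr.
  by apply: (le_trans h2); rewrite ler_pM2l//; lra.
have h4 : h * (4 * A ^+ 2 * B) <= e by rewrite -ler_pdivlMr// ltW.
have h5 : 2 * (A ^+ 2 * h ^+ 2) * B = h * (4 * A ^+ 2 * B) * h / 2.
  by field.
have h6 : h * (4 * A ^+ 2 * B) * h <= e * h by rewrite ler_wpM2r// ltW.
lra.
Qed.

Let orbit t := expR (l * t) *: T t x.
Let L := expR `|l|.

Let expR_L t : 0 <= t <= 1 -> expR (l * t) <= L.
Proof.
move=> /andP[t0 t1]; rewrite ler_expR; apply: (le_trans (ler_norm _)).
by rewrite normrM (ger0_norm t0) ler_piMr.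
Qed.

Let orbit_step s h : 0 <= s -> 0 <= h -> s + h <= 1 ->
  N (orbit (s + h) - orbit s) <= L * N (T s (residual h)).
Proof.
move=> s0 h0 sh.
have -> : orbit (s + h) - orbit s =
    expR (l * (s + h)) *: (T (s + h) x - expR (- (l * h)) *: T s x).
  by rewrite /orbit scalerBr scalerA -expRD mulrDr addrK.
rewrite NZ ger0_norm ?expR_ge0//; apply: ler_pM => //; rewrite ?expR_ge0//.
  by apply: expR_L; apply/andP; split; lra.
have s01 : 0 <= s <= 1 by apply/andP; split; lra.
have h1 := T_add s0 h0 sh x.
have h2 := T_linear s01 (- expR (- (l * h))) x (T h x).
have h3 := N_sub (T (s + h) x) (T s (T h x)) (expR (- (l * h)) *: T s x).
have h4 := N_le (T s (T h x) - expR (- (l * h)) *: T s x) (T s (residual h)).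
move: h2; rewrite !scaleNr ![- _ + _]addrC -/(residual h) N_subC => h2.
by move: h3; rewrite h1 add0r => h3; move: h4; rewrite h2 add0r; exact: le_trans.
Qed.

(** Cutting [[s, t]] into [n] equal steps gives [n] errors of size [o(1 / n)],
    with a common factor since the operators are bounded by [K] there. *)
Let orbit_locally_constant a b K : 0 < a -> b < 1 ->
  (forall t, a <= t < b -> forall y, N (T t y) <= K * N y) ->
  forall s t, a <= s -> s < t -> t < b -> N (orbit t - orbit s) = 0.
Proof.
move=> a0 b1 TK s t as_ st tb; apply/eqP; rewrite eq_le N_ge0 andbT.
have K0 : 0 <= `|K| + 1 by rewrite addr_ge0.
have L0 : 0 < L by exact: expR_gt0.
suff H e : 0 < e -> N (orbit t - orbit s) <= (L * (`|K| + 1) * (t - s)) * e.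
  apply/ler_addgt0Pl => e e0; rewrite addr0.
  have c0 : 0 < L * (`|K| + 1) * (t - s).
    by rewrite !mulr_gt0//; have := normr_ge0 K; lra.
  by have := H _ (divr_gt0 e0 c0); rewrite mulrCA mulfV ?gt_eqF// mulr1.
move=> e0; have [d d0 dr] := residual_small e0.
pose n := (Num.trunc ((t - s) / d)).+1.
have n0 : 0 < n%:R :> R by rewrite ltr0n.
pose h := (t - s) / n%:R.
have h0 : 0 < h by rewrite divr_gt0//; lra.
have nh : n%:R * h = t - s by rewrite /h mulrCA mulfV ?gt_eqF// mulr1.
have hd : h < d.
  by rewrite /h ltr_pdivrMr// mulrC -ltr_pdivrMr// truncnS_gt.
have hh : 0 < h < d by rewrite h0.
have step m : (m <= n)%N ->
    N (orbit (s + m%:R * h) - orbit s) <= m%:R * (L * (`|K| + 1) * (e * h)).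
  elim: m => [|m IH] mn; first by rewrite !mul0r addr0 subrr N_0.
  have mn' : m.+1%:R * h <= n%:R * h by rewrite ler_wpM2r ?ler_nat// ltW.
  have mh : m.+1%:R * h = m%:R * h + h by rewrite -natr1 mulrDl mul1r.
  have mh0 : 0 <= m%:R * h by rewrite mulr_ge0// ltW.
  have smh : a <= s + m%:R * h < b by apply/andP; split; lra.
  have h1 : N (orbit (s + m.+1%:R * h) - orbit (s + m%:R * h)) <=
      L * N (T (s + m%:R * h) (residual h)).
    by have := @orbit_step (s + m%:R * h) h; rewrite -addrA -mh; apply; lra.
  have h2 := N_sub (orbit (s + m.+1%:R * h)) (orbit (s + m%:R * h)) (orbit s).
  have h3 : L * N (T (s + m%:R * h) (residual h)) <= L * (`|K| + 1) * (e * h).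
    rewrite -mulrA ler_pM2l//; apply: (le_trans (TK _ smh _)).
    apply: (@le_trans _ _ (`|K| * N (residual h))).
      by rewrite ler_wpM2r// ler_norm.
    by apply: ler_pM => //; [lra|exact: dr].
  rewrite [leRHS](_ : _ = L * (`|K| + 1) * (e * h) +
    m%:R * (L * (`|K| + 1) * (e * h))); last by rewrite -natr1; ring.
  apply: (le_trans h2); apply: lerD; last exact: (IH (ltnW mn)).
  exact: le_trans h1 h3.
have := step n (leqnn _); rewrite nh subrKC => H.
apply: (le_trans H); rewrite -nh le_eqVlt; apply/orP; left; apply/eqP; ring.
Qed.

(** Applying [T c] transports constancy of the orbit to later times, where no
    uniform bound is known. *)
Let orbit_shift s t c : 0 <= s -> 0 <= t -> 0 <= c -> s + c <= 1 -> t + c <= 1 ->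
  N (orbit t - orbit s) = 0 -> N (orbit (t + c) - orbit (s + c)) = 0.
Proof.
move=> s0 t0 c0 sc tc ts; apply/eqP; rewrite eq_le N_ge0 andbT.
have c01 : 0 <= c <= 1 by apply/andP; split; lra.
have [C C0 TC] := T_lipschitz c01.
have key u : 0 <= u -> u + c <= 1 ->
    N (orbit (u + c) - expR (l * c) *: T c (orbit u)) = 0.
  move=> u0 uc; apply/eqP; rewrite eq_le N_ge0 andbT.
  have := T_scale (expR (l * u)) (T u x) c01; rewrite -/(orbit u) => h1.
  have h2 := T_add c0 u0; rewrite addrC in h2; have {}h2 := h2 uc x.
  have h3 := N_sub (orbit (u + c))
    (expR (l * c) *: (expR (l * u) *: T c (T u x)))
    (expR (l * c) *: T c (orbit u)).
  have h4 : N (orbit (u + c) - expR (l * c) *: (expR (l * u) *: T c (T u x))) = 0.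
    rewrite /orbit scalerA -expRD -mulrDr [c + u]addrC -scalerBr NZ h2.
    by rewrite mulr0.
  have h5 : N (expR (l * c) *: (expR (l * u) *: T c (T u x)) -
      expR (l * c) *: T c (orbit u)) = 0.
    by rewrite -scalerBr NZ N_subC h1 mulr0.
  by move: h3; rewrite h4 h5 addr0.
have h1 := key t t0 tc; have h2 := key s s0 sc; rewrite N_subC in h2.
have h3 : N (expR (l * c) *: T c (orbit t) - expR (l * c) *: T c (orbit s)) = 0.
  apply/eqP; rewrite eq_le N_ge0 andbT -scalerBr NZ.
  have := TC (orbit t) (orbit s); rewrite ts mulr0 => h.
  by rewrite mulr_ge0_le0.
have h4 := N_sub (orbit (t + c)) (expR (l * c) *: T c (orbit t)) (orbit (s + c)).
have h5 := N_sub (expR (l * c) *: T c (orbit t))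
  (expR (l * c) *: T c (orbit s)) (orbit (s + c)).
lra.
Qed.

(** The orbit [expR (l t) T_t x] is constant on a short interval [[a, b)] where
    the operators are uniformly bounded, hence on [[a, 1]] by shifting; as [a]
    may be taken arbitrarily small, its value there is its limit [x] at [0]. *)
Lemma semigroup_eigenvector : N (T 1 x - expR (- l) *: x) = 0.
Proof.
have L0 : 0 < L by exact: expR_gt0.
suff H : N (orbit 1 - x) = 0.
  have -> : T 1 x - expR (- l) *: x = expR (- l) *: (orbit 1 - x).
    by rewrite /orbit mulr1 scalerBr scalerA -expRD addNr expR0 scale1r.
  by rewrite NZ H mulr0.
apply/eqP; rewrite eq_le N_ge0 andbT; apply/ler_addgt0Pl => e e0; rewrite addr0.
have [d d0 dr] := residual_small (divr_gt0 e0 L0).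
pose d1 := Num.min d 1.
have d10 : 0 < d1 <= 1 by rewrite /d1 lt_min d0 ltr01 ge_min lexx orbT.
have d1d : d1 <= d by rewrite ge_min lexx.
have [a [b [K [a0 ab bd TK]]]] := semigroup_locally_bounded d10.
have [_ d11] := andP d10.
have b1 : b < 1 by lra.
have loc := orbit_locally_constant a0 b1 TK.
pose n := (Num.trunc ((1 - a) / (b - a))).+1.
have n0 : 0 < n%:R :> R by rewrite ltr0n.
pose h := (1 - a) / n%:R.
have h0 : 0 < h by rewrite divr_gt0//; lra.
have nh : n%:R * h = 1 - a by rewrite /h mulrCA mulfV ?gt_eqF// mulr1.
have hd : h < b - a.
  by rewrite /h ltr_pdivrMr// mulrC -ltr_pdivrMr ?truncnS_gt//; lra.
have step m : (m <= n)%N -> N (orbit (a + m%:R * h) - orbit a) = 0.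
  elim: m => [|m IH] mn; first by rewrite mul0r addr0 subrr N_0.
  have mn' : m.+1%:R * h <= n%:R * h by rewrite ler_wpM2r ?ler_nat// ltW.
  have mh : m.+1%:R * h = m%:R * h + h by rewrite -natr1 mulrDl mul1r.
  have mh0 : 0 <= m%:R * h by rewrite mulr_ge0// ltW.
  have h1 : N (orbit (a + h) - orbit a) = 0 by apply: loc; lra.
  have h2 : N (orbit (a + h + m%:R * h) - orbit (a + m%:R * h)) = 0.
    by apply: orbit_shift => //; lra.
  have h3 := N_sub (orbit (a + m.+1%:R * h)) (orbit (a + m%:R * h)) (orbit a).
  have h4 := N_ge0 (orbit (a + m.+1%:R * h) - orbit a).
  move: h3 h4; rewrite (IH (ltnW mn)) addr0 mh [m%:R * h + h]addrC addrA h2; lra.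
have h1 : N (orbit 1 - orbit a) = 0.
  by have := step n (leqnn n); rewrite nh subrKC.
have h2 : N (orbit a - x) <= e.
  have ad : 0 < a < d by apply/andP; split; lra.
  have -> : orbit a - x = expR (l * a) *: residual a.
    by rewrite /orbit /residual scalerBr scalerA -expRD subrr expR0 scale1r.
  rewrite NZ ger0_norm ?expR_ge0//.
  have h3 := dr _ ad.
  have h4 : expR (l * a) <= L by apply: expR_L; apply/andP; split; lra.
  apply: (@le_trans _ _ (L * (e / L * a))).
    by apply: ler_pM => //; exact: expR_ge0.
  by rewrite mulrA mulrCA mulfV ?gt_eqF// mulr1 ler_piMr//; lra.
have := N_sub (orbit 1) (orbit a) x; lra.
Qed.

End semigroup_eigenvector.

(** * Symmetry of the heat kernel *)
Section L2_seminorm.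
Context {R : realType} (mu : probability (SO2 R) R).
Implicit Types (f h : L2 mu).

Definition L2seminorm f : R := fine (L2norm mu f).

Lemma L2seminormE f : (L2seminorm f)%:E = L2norm mu f.
Proof. exact: (finite_norm_fine f). Qed.

Lemma L2seminormD f h : L2seminorm (f + h) <= L2seminorm f + L2seminorm h.
Proof. exact: (ler_LnormD f h). Qed.

Lemma L2seminormZ (a : R) f : L2seminorm (a *: f) = `|a| * L2seminorm f.
Proof.
apply: EFin_inj; rewrite EFinM !L2seminormE.
exact: (LnormZ f a).
Qed.

Lemma L2seminorm_eq0 f h : L2seminorm (f - h) = 0 <-> f = h %[ae mu].
Proof.
split.
  move/fine_Lnormr_eq0; apply: filterS => g /(_ I) /= /eqP.
  by rewrite subr_eq0 => /eqP.
move=> fh; apply: EFin_inj; rewrite L2seminormE.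
have fh0 : \forall g \ae mu, setT g -> (EFin \o (f - h : L2 mu)) g = cst 0%E g.
  apply: filterS fh => g /(_ I) fg _ /=.
  by congr EFin; apply/eqP; rewrite subr_eq0 fg.
rewrite /L2norm unlock /Lnorm.
rewrite (ae_eq_integral (cst 0%E))//.
- by rewrite integral0 poweR0r// invr_eq0.
- apply/measurable_EFinP.
  apply: (@measurableT_comp _ _ _ _ _ _ (@powR R ^~ 2)) => //.
  exact: measurableT_comp.
- by apply: filterS fh0 => g /(_ I) [fg0] _ /=; rewrite fg0 normr0 powR0.
Qed.

Lemma continuous_L2 (f : SO2 R -> R) : continuous f ->
  exists F : L2 mu, F = f :> (SO2 R -> R).
Proof.
move=> fc; have fm := continuous_measurable_SO2 fc.
suff fL : f \in Lfun mu 2%:E by exists (Lfun_Sub (lee1n 2) fL).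
apply/andP; split; rewrite inE//= /finite_norm unlock poweR_lty//.
have [M M0 fM] := SO2_bound fc.
apply: integrable_lty => //.
apply: (@bounded_integrable_SO2 _ mu (fun g => `|f g| `^ 2) (M `^ 2)).
  apply: (@measurableT_comp _ _ _ _ _ _ (@powR R ^~ 2)) => //.
  exact: measurableT_comp.
by move=> g; rewrite ger0_norm ?powR_ge0// ge0_ler_powR// nnegrE// ltW.
Qed.

End L2_seminorm.

Lemma near_right0 {R : realType} (P : R -> Prop) :
  (\forall t \near 0^'+, P t) ->
  exists2 d : R, 0 < d & forall t, 0 < t < d -> P t.
Proof.
move=> /nbhs_ballP[d /= d0 dP]; exists d => // t /andP[t0 td].
by apply: dP => //; rewrite /ball/= sub0r normrN gtr0_norm.
Qed.

Section heat_kernel_symmetry.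
Context {R : realType} (sigma : R) (ip : 'M[R]_2 -> 'M[R]_2 -> R).
Variables (mu : probability (SO2 R) R) (T : R -> L2 mu -> L2 mu).
Variable k : SO2 R -> SO2 R -> R.
Hypotheses (hip : Ad_invariant_inner_product ip) (hmu : is_haar mu).
Hypotheses (hT : heat_semigroup ip sigma T) (kT : is_kernel_of k (T 1)).
Hypothesis k_cont : continuous (fun u : SO2 R * SO2 R => k u.1 u.2).

Let rate n := sigma ^+ 2 / 2 * (n%:R ^+ 2 / ip J_mx J_mx).

Lemma trigSO2_continuous n (c : R) : continuous (trigSO2 n c).
Proof.
apply: smooth_continuous.
rewrite (_ : trigSO2 n c = (fun g => 1 * trigSO2 n c g)).
  exact: smooth_trigSO2.
by apply/funext => g; rewrite mul1r.
Qed.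

Lemma cvg_L2norm0 (F : R -> L2 mu) (e : R) : 0 < e ->
  L2norm mu (F t) @[t --> 0^'+] --> 0%E ->
  exists2 d : R, 0 < d & forall t, 0 < t < d -> L2seminorm (F t) < e.
Proof. by move=> e0 /fine_cvg F0; apply: near_right0; exact: cvgr_lt F0 e e0. Qed.

Lemma heat_trigSO2 n c (f : L2 mu) : f = trigSO2 n c :> (SO2 R -> R) ->
  L2seminorm (T 1 f - expR (- rate n) *: f) = 0.
Proof.
move=> fE; apply: semigroup_eigenvector.
- exact: L2seminormD.
- exact: L2seminormZ.
- by move=> t t01 a y z; apply/L2seminorm_eq0; exact: (heat_linear hT).
- move=> t t01; have [C TC] := heat_bounded hT t01; exists C => y.
  by rewrite -lee_fin EFinM !L2seminormE; exact: TC.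
- by move=> s t s0 t0 st y; apply/L2seminorm_eq0; exact: (heat_add hT).
- by move=> y e e0; apply: cvg_L2norm0 => //; exact: (heat_continuous hT).
- move=> e e0.
  pose u : L2 mu := - (n%:R ^+ 2 / ip J_mx J_mx) *: f.
  have uE : u = (fun g => - (n%:R ^+ 2 / ip J_mx J_mx) * trigSO2 n c g)
      :> (SO2 R -> R).
    by apply/funext => g; rewrite -fE.
  have lap : is_laplacian ip mu f u by rewrite fE uE; exact: trigSO2_laplacian.
  have [d d0 dT] := cvg_L2norm0 e0 (heat_generator hT lap).
  exists d => // t td; have /andP[t0 _] := td.
  have -> : T t f - f + (rate n * t) *: f =
      t *: (t^-1 *: (T t f - f) - (sigma ^+ 2 / 2) *: u).
    rewrite scalerBr scalerA mulfV ?gt_eqF// scale1r; congr (_ + _).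
    by rewrite /u !scalerA -scaleNr; congr (_ *: _); rewrite /rate; ring.
  by rewrite L2seminormZ gtr0_norm// mulrC ler_pM2r// ltW// dT.
Qed.

Lemma kernel_trigSO2 n c g :
  kernel_op mu k (trigSO2 n c) g = expR (- rate n) * trigSO2 n c g.
Proof.
have tc := @trigSO2_continuous n c.
have [f fE] := continuous_L2 mu tc.
apply: (continuous_ae_eq hmu (f2 := fun g => expR (- rate n) * trigSO2 n c g)).
- exact: kernel_op_continuous.
- by apply: contM => //; exact: cont_cst.
- have := kT f; have /L2seminorm_eq0 := heat_trigSO2 fE.
  apply: filterS2 => x /(_ I) T1 /(_ I) T2 _.
  by rewrite -fE -T2 T1.
Qed.

(* Integral of the kernel against the translate of [w] centred at angle [b]; its
   symmetry in [a] and [b] for peaked [w] approximates that of the kernel. *)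
Let conv (w : SO2 R -> R) (a b : R) :=
  \int[mu]_h (k (rotSO2 a) h * w (mulSO2 (rotSO2 (- b)) h)).

Let k_contr g : continuous (k g) := cont_comp (@pair_continuousr _ _ g) k_cont.

Let conv_cont (w : SO2 R -> R) (a b : R) : continuous w ->
  continuous (fun h => k (rotSO2 a) h * w (mulSO2 (rotSO2 (- b)) h)).
Proof.
by move=> wc; apply: contM => //; exact: cont_comp (@mulSO2_continuous R _) wc.
Qed.

Let conv_sym (w : SO2 R -> R) := forall a b : R, conv w a b = conv w b a.

Let conv_sym_lin (w1 w2 : SO2 R -> R) (c1 c2 : R) :
  continuous w1 -> continuous w2 -> conv_sym w1 -> conv_sym w2 ->
  conv_sym (fun h => c1 * w1 h + c2 * w2 h).
Proof.
move=> w1c w2c s1 s2.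
have E a b : conv (fun h => c1 * w1 h + c2 * w2 h) a b =
    c1 * conv w1 a b + c2 * conv w2 a b.
  have i1 := continuous_integrable_SO2 mu (@conv_cont w1 a b w1c).
  have i2 := continuous_integrable_SO2 mu (@conv_cont w2 a b w2c).
  rewrite /conv -(RintegralZl _ measurableT i1) -(RintegralZl _ measurableT i2).
  rewrite -RintegralD//.
  - by apply: eq_Rintegral => h _; ring.
  - apply: continuous_integrable_SO2; apply: contM; first exact: cont_cst.
    exact: conv_cont.
  - apply: continuous_integrable_SO2; apply: contM; first exact: cont_cst.
    exact: conv_cont.
by move=> a b; rewrite !E s1 s2.
Qed.

Let peak (g : SO2 R) : R := (1 + cosSO2 g) / 2.

Let peak_cont : continuous peak.
Proof.
apply: contM; last exact: cont_cst.
by apply: contD; [exact: cont_cst|exact: cosSO2_continuous].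
Qed.

Let peak_trig m n := fun h => peak h ^+ m * trigSO2 n 0 h.

Let peak_trig_cont m n : continuous (peak_trig m n).
Proof. by apply: contM; [exact: contX|exact: trigSO2_continuous]. Qed.

Let conv_trig_sym n : conv_sym (trigSO2 n 0).
Proof.
have shift u h :
    trigSO2 n 0 (mulSO2 (rotSO2 (- u)) h) = trigSO2 n (- (n%:R * u)) h.
  have [t [_ ->]] := rotSO2_surj h; rewrite -rotSO2D !trigSO2_rot.
  by congr cos; ring.
have E u v :
    conv (trigSO2 n 0) u v = expR (- rate n) * cos (n%:R * u - n%:R * v).
  rewrite -trigSO2_rot -kernel_trigSO2.
  by apply: eq_Rintegral => h _; rewrite shift.
by move=> a b; rewrite !E -(cosN (n%:R * a - _)) opprB.
Qed.

Let conv_peak_sym m n : conv_sym (peak_trig m n).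
Proof.
have pc := peak_trig_cont.
elim: m n => [|m IH] n.
  rewrite (_ : peak_trig 0 n = trigSO2 n 0); first exact: conv_trig_sym.
  by apply/funext => h; rewrite /peak_trig expr0 mul1r.
case: n => [|n].
  rewrite (_ : peak_trig m.+1 0 =
      (fun h => 1 / 2 * peak_trig m 0 h + 1 / 2 * peak_trig m 1 h)).
    by apply: conv_sym_lin; [exact: pc|exact: pc|exact: IH|exact: IH].
  apply/funext => h; rewrite /peak_trig /peak exprS.
  have [t [_ ->]] := rotSO2_surj h; rewrite !trigSO2_rot cosSO2_rot.
  by rewrite mul0r !addr0 cos0 (mul1r t); set p := _ ^+ m; field.
(* cos t * cos ((n + 1) t) is the average of cos (n t) and cos ((n + 2) t). *)
pose w h := 1 / 4 * peak_trig m n h + 1 / 4 * peak_trig m n.+2 h.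
have wc : continuous w.
  by apply: contD; apply: contM; (exact: cont_cst || exact: pc).
have ws : conv_sym w.
  by apply: conv_sym_lin; [exact: pc|exact: pc|exact: IH|exact: IH].
rewrite (_ : peak_trig m.+1 n.+1 =
    (fun h => 1 / 2 * peak_trig m n.+1 h + 1 * w h)).
  by apply: conv_sym_lin; [exact: pc|exact: wc|exact: IH|exact: ws].
apply/funext => h; rewrite /w /peak_trig /peak exprS.
have [t [_ ->]] := rotSO2_surj h; rewrite !trigSO2_rot cosSO2_rot !addr0.
have -> : n%:R * t = n.+1%:R * t - t by rewrite -natr1; ring.
have -> : n.+2%:R * t = n.+1%:R * t + t by rewrite -[n.+2%:R]natr1; ring.
by rewrite cosB cosD; set p := _ ^+ m; field.
Qed.

Let peak_ge0 h : 0 <= peak h.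
Proof.
have [t [_ ->]] := rotSO2_surj h; rewrite /peak cosSO2_rot.
by have := cos_geN1 t; lra.
Qed.

Let peak_le1 h : peak h <= 1.
Proof.
have [t [_ ->]] := rotSO2_surj h; rewrite /peak cosSO2_rot.
by have := cos_le1 t; lra.
Qed.

Let peak_1 : peak oneSO2 = 1.
Proof. by rewrite /peak cosSO2_1; field. Qed.

Let peak_eq1 h : peak h = 1 -> h = oneSO2.
Proof.
rewrite /peak => p1; have c1 : cosSO2 h = 1 by lra.
have := cosSO2D1 h; rewrite c1 expr1n => s0.
have /eqP : sinSO2 h ^+ 2 = 0 by lra.
rewrite sqrf_eq0 => /eqP {}s0; apply: SO2_inj; first by rewrite c1 cosSO2_1.
by rewrite s0 -rotSO20 sinSO2_rot sin0.
Qed.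

(** If [Phi oneSO2 > 0], then [Phi > c > 0] wherever [peak > r], for some
    [r < 1].  The integral of [Phi * peak ^ m] would then be at least
    [c * \int peak ^ m - O(r ^ m)], whereas [\int peak ^ m] is at least
    [mu U * s ^ m] with [s > r]. *)
Let peak_detects (Phi : SO2 R -> R) : continuous Phi ->
  (forall m, \int[mu]_h (Phi h * peak h ^+ m) = 0) -> Phi oneSO2 <= 0.
Proof.
move=> Pc P0; rewrite leNgt; apply/negP => P1.
pose c := Phi oneSO2 / 2; have c0 : 0 < c by rewrite /c; lra.
have [M M0 PM] := SO2_bound Pc.
have [r [r0 r1 rP]] : exists r : R, [/\ 0 < r, r < 1 &
    forall h, Phi h <= c -> peak h <= r].
  have [[a aA]|A0] := pselect ([set h | Phi h <= c] !=set0); last first.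
    exists (1 / 2); split; try lra.
    by move=> h hc; exfalso; apply: A0; exists h.
  have cA : compact [set h | Phi h <= c].
    apply: (subclosed_compact _ (@SO2_compact R)) => //.
    have /continuous_closedP oc := Pc.
    exact: (oc [set y | y <= c] (@closed_le R c)).
  have [|b bA bmax] := compact_EVT_max _ cA (continuous_subspaceT peak_cont).
    by exists a.
  exists (Num.max (1 / 2) (peak b)); split.
  - by rewrite lt_max; apply/orP; left; lra.
  - rewrite gt_max; apply/andP; split; first lra.
    rewrite lt_neqAle peak_le1 andbT; apply/eqP => /peak_eq1 b1.
    by move: bA; rewrite inE /= b1 /c; lra.
  - by move=> h hc; rewrite le_max bmax ?orbT// inE.
pose s := (1 + r) / 2.
have s0 : 0 < s by rewrite /s; lra.
pose U := [set h | s < peak h].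
have oU : open U.
  by have /continuousP oc := peak_cont; exact: (oc [set y | s < y] (@open_gt R s)).
have mU := open_measurable_SO2 oU.
have muU : (0 < mu U)%E.
  by apply: (haar_open_gt0 hmu oU); exists oneSO2; rewrite /U/= peak_1 /s; lra.
have fU : mu U \is a fin_num by exact: fin_num_measure.
pose u := fine (mu U).
have u0 : 0 < u by rewrite fine_gt0// muU ltey_eq fU.
have pc m : continuous (fun h => peak h ^+ m) by exact: contX.
have low m : s ^+ m * u <= \int[mu]_h (peak h ^+ m).
  have iU : mu.-integrable setT (EFin \o (\1_U : SO2 R -> R)).
    exact: integrable_indic.
  have -> : s ^+ m * u = \int[mu]_h (s ^+ m * \1_U h).
    by rewrite RintegralZl// /Rintegral integral_indic// setIT.
  apply: le_Rintegral => //.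
  - apply: (@bounded_integrable_SO2 _ mu (fun h => s ^+ m * \1_U h) (s ^+ m)).
      by apply: measurable_funM => //; exact: measurable_indic.
    move=> h; rewrite normrM (ger0_norm (exprn_ge0 _ (ltW s0))) ler_piMr//.
      exact/exprn_ge0/ltW.
    by rewrite indicE; case: (_ \in _); rewrite ?normr1 ?normr0.
  - exact: continuous_integrable_SO2.
  - move=> h _; rewrite indicE; case: (boolP (h \in U)) => [|_].
      by rewrite inE => /ltW sh; rewrite mulr1 lerXn2r// nnegrE// ltW.
    by rewrite mulr0 exprn_ge0.
have up m : c * \int[mu]_h (peak h ^+ m) <= (M + c) * r ^+ m.
  have H : \int[mu]_h (c * peak h ^+ m - (M + c) * r ^+ m) <=
      \int[mu]_h (Phi h * peak h ^+ m).
    apply: le_Rintegral_cont.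
    - apply: contB; last exact: cont_cst.
      by apply: contM => //; exact: cont_cst.
    - exact: contM.
    - move=> h; have [Pch|Pch] := ltP c (Phi h).
        have := ler_wpM2r (exprn_ge0 m (peak_ge0 h)) (ltW Pch).
        have : 0 <= (M + c) * r ^+ m.
          by rewrite mulr_ge0// ?exprn_ge0//; lra.
        lra.
      have pr : peak h ^+ m <= r ^+ m by rewrite lerXn2r// ?nnegrE ?rP// ltW.
      have p0 := exprn_ge0 m (peak_ge0 h).
      have h1 : c * peak h ^+ m <= c * r ^+ m by rewrite ler_pM2l.
      have h2 : M * peak h ^+ m <= M * r ^+ m by rewrite ler_pM2l.
      have h3 : - M * peak h ^+ m <= Phi h * peak h ^+ m.
        apply: ler_wpM2r => //; have := PM h; rewrite ler_norml => /andP[//].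
      lra.
  rewrite P0 RintegralB// in H; last 2 first.
  - by apply: continuous_integrable_SO2; apply: contM => //; exact: cont_cst.
  - by apply: continuous_integrable_SO2; exact: cont_cst.
  rewrite Rintegral_const RintegralZl// in H; last first.
    exact: continuous_integrable_SO2.
  lra.
have z1 : `|r / s| < 1.
  have rs0 : 0 <= r / s by apply: divr_ge0; exact: ltW.
  by rewrite ger0_norm// ltr_pdivrMr// mul1r /s; lra.
have cu0 : 0 < c * u / (M + c) by rewrite divr_gt0 ?mulr_gt0//; lra.
have [m _ mP] := cvgr_lt _ (cvg_expr z1) _ cu0.
have := mP m (leqnn m); rewrite /= expr_div_n ltNge => /negP; apply.
rewrite ler_pdivrMr; last lra.
rewrite [leRHS]mulrAC ler_pdivlMr ?exprn_gt0//.
have := up m; have := low m; rewrite -(ler_pM2l c0) => l1 l2.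
have l3 := le_trans l1 l2.
rewrite (_ : c * u * s ^+ m = c * (s ^+ m * u)); last by ring.
by rewrite [leRHS]mulrC.
Qed.

(** By invariance the symmetry of [conv] for [peak ^ m] reads
    [\int Phi * peak ^ m = 0], where [Phi oneSO2 = k g h - k h g]. *)
Lemma heat_kernel_sym g h : k g h = k h g.
Proof.
suff le g' h' : k g' h' <= k h' g' by apply/eqP; rewrite eq_le !le.
have [a [_ ->]] := rotSO2_surj g'; have [b [_ ->]] := rotSO2_surj h'.
pose Phi x := k (rotSO2 a) (mulSO2 (rotSO2 b) x) -
              k (rotSO2 b) (mulSO2 (rotSO2 a) x).
have kc u v : continuous (fun x => k (rotSO2 u) (mulSO2 (rotSO2 v) x)).
  exact: cont_comp (@mulSO2_continuous R _) (@k_contr _).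
have Pc : continuous Phi by exact: contB.
have convE m u v : conv (fun x => peak x ^+ m) u v =
    \int[mu]_x (k (rotSO2 u) (mulSO2 (rotSO2 v) x) * peak x ^+ m).
  have pc : continuous (fun x => peak x ^+ m) by exact: contX.
  rewrite /conv -(haar_Rintegral hmu (rotSO2 v) (@conv_cont _ u v pc)).
  apply: eq_Rintegral => x _; rewrite mulSO2A -rotSO2D addNr rotSO20.
  by rewrite [mulSO2 oneSO2 _]mulSO2C mulSO21.
have := @peak_detects Phi Pc; rewrite /Phi !mulSO21 subr_le0; apply => m.
have pE : peak_trig m 0 = (fun x => peak x ^+ m).
  apply/funext => x; have [t [_ ->]] := rotSO2_surj x.
  by rewrite /peak_trig trigSO2_rot mul0r addr0 cos0 mulr1.
have := conv_peak_sym m 0 a b; rewrite pE !convE => /eqP.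
rewrite -subr_eq0 -RintegralB//; last 2 first.
- by apply: continuous_integrable_SO2; apply: contM => //; exact: contX.
- by apply: continuous_integrable_SO2; apply: contM => //; exact: contX.
by move=> /eqP <-; apply: eq_Rintegral => x _; rewrite mulrBl.
Qed.

End heat_kernel_symmetry.

(** * Projective contraction and the fixed point *)
Lemma uniform_approx_continuous {R : realType} {T : topologicalType}
    (u : T -> R) :
  (forall e : R, 0 < e -> exists2 f : T -> R, continuous f &
     forall x, `|u x - f x| <= e) ->
  continuous u.
Proof.
move=> uf x; apply/cvgrPdist_lt => e e0.
have e30 : 0 < e / 3 by lra.
have [f fc fu] := uf _ e30.
have := fc x; move/cvgrPdist_lt => /(_ _ e30); apply: filterS => y fxy.
rewrite (_ : u x - u y = (u x - f x) + (f x - f y) - (u y - f y)); last by ring.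
have h1 := ler_normB ((u x - f x) + (f x - f y)) (u y - f y).
have h2 := ler_normD (u x - f x) (f x - f y).
have h3 := fu x; have h4 := fu y; lra.
Qed.

Lemma geometric_small {R : realType} (c D e : R) : 0 <= c < 1 -> 0 < e ->
  exists n, c ^+ n * D <= e.
Proof.
move=> /andP[c0 c1] e0; have D0 : 0 < `|D| + 1 by rewrite ltr_wpDl.
have c1' : `|c| < 1 by rewrite ger0_norm.
have [n _ nP] := cvgr_lt _ (cvg_expr c1') _ (divr_gt0 e0 D0).
exists n; have := nP n (leqnn n); rewrite /= ltr_pdivlMr// => /ltW; apply: le_trans.
by rewrite ler_wpM2l ?exprn_ge0//; have := ler_norm D; lra.
Qed.

Section projective_contraction.
Context {R : realType} (mu : probability (SO2 R) R).
Variable k : SO2 R -> SO2 R -> R.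
Hypothesis k_cont : continuous (fun u : SO2 R * SO2 R => k u.1 u.2).
Hypothesis k_pos : forall g h, 0 < k g h.
Implicit Types (f g phi : SO2 R -> R) (m M c : R).

Let T := kernel_op mu k.

Definition ratio_between m M g f : Prop :=
  forall x, m * g x <= f x /\ f x <= M * g x.

Let k_contr x : continuous (k x) := cont_comp (@pair_continuousr _ _ x) k_cont.

Let Tcont f : continuous f -> continuous (T f).
Proof. exact: kernel_op_continuous. Qed.

Lemma kernel_op_Cplus f : Cplus f -> Cplus (T f).
Proof.
move=> [fc f0]; split; first exact: Tcont.
by move=> x; apply: Rintegral_gt0 => [|h]; [exact: contM|exact: mulr_gt0].
Qed.

Lemma Cplus_div f g : Cplus f -> Cplus g -> Cplus (fun x => f x / g x).
Proof.
move=> [fc f0] [gc g0]; split; last by move=> x; rewrite divr_gt0.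
by apply: contM => //; apply: contV => // x; rewrite gt_eqF.
Qed.

Lemma Cplus_ratio f g : Cplus f -> Cplus g ->
  exists m M, 0 < m /\ ratio_between m M g f.
Proof.
move=> fC gC; have [rc r0] := Cplus_div fC gC; have [_ g0] := gC.
have [m m0 rm] := compact_pos_bound oneSO2 (@SO2_compact R) rc r0.
have [M _ rM] := SO2_bound rc.
exists m, M; split => // x; split; first by rewrite -ler_pdivlMr//; exact: rm.
by rewrite -ler_pdivrMr//; exact: le_trans (ler_norm _) (rM x).
Qed.

Lemma ratio_between_le m M g f : Cplus g -> ratio_between m M g f -> m <= M.
Proof.
move=> [_ g0] /(_ oneSO2)[h1 h2].
by rewrite -(ler_pM2r (g0 oneSO2)); exact: le_trans h1 h2.
Qed.

Lemma ratio_betweenW m m' M M' g f : Cplus g -> m <= m' -> M' <= M ->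
  ratio_between m' M' g f -> ratio_between m M g f.
Proof.
move=> [_ g0] mm MM H x; have [h1 h2] := H x; split.
  by apply: le_trans h1; rewrite ler_pM2r.
by apply: (le_trans h2); rewrite ler_pM2r.
Qed.

(** With [s] the mean of [f - m g] relative to that of [g], the bounds
    [a <= k <= b] give [T f - m T g >= (a / b) s T g]; likewise for [M g - f],
    whose relative mean is [M - m - s]. *)
Lemma kernel_op_contraction : exists2 c, 0 <= c < 1 &
  forall m M f g, Cplus f -> Cplus g -> ratio_between m M g f ->
  exists m' M', [/\ m <= m', M' <= M, M' - m' = c * (M - m)
                  & ratio_between m' M' (T g) (T f)].
Proof.
have [a a0 ka] := compact_pos_bound (oneSO2, oneSO2) SO2X_compact k_cont
  (fun u => k_pos u.1 u.2).
have [b b0 kb] := compact_bound (oneSO2, oneSO2) SO2X_compact k_cont.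
have {}kb x y : k x y <= b by exact: le_trans (ler_norm _) (kb (x, y)).
have {}ka x y : a <= k x y by exact: ka (x, y).
have ab : a <= b := le_trans (ka oneSO2 oneSO2) (kb oneSO2 oneSO2).
pose e := a / b.
have e0 : 0 < e by rewrite divr_gt0.
have e1 : e <= 1 by rewrite ler_pdivrMr// mul1r.
exists (1 - e); first by apply/andP; split; lra.
move=> m M f g [fc f0] [gc g0] H.
have I0 := Rintegral_gt0 mu gc g0.
set Ig := \int[mu]_h g h in I0.
set Jf := \int[mu]_h f h.
have low (w : SO2 R -> R) : continuous w -> (forall h, 0 <= w h) ->
    forall x, e * (\int[mu]_h w h / Ig) * T g x <= T w x.
  move=> wc w0 x.
  have Tg : T g x <= b * Ig.
    rewrite -RintegralZl//; last exact: continuous_integrable_SO2.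
    apply: le_Rintegral_cont => [||h]; first exact: contM.
      by apply: contM => //; exact: cont_cst.
    by rewrite ler_pM2r.
  have Tw : a * \int[mu]_h w h <= T w x.
    rewrite -RintegralZl//; last exact: continuous_integrable_SO2.
    apply: le_Rintegral_cont => [||h]; [|exact: contM|].
      by apply: contM => //; exact: cont_cst.
    by apply: ler_wpM2r.
  have W0 : 0 <= \int[mu]_h w h by exact: Rintegral_ge0.
  apply: le_trans Tw.
  rewrite (_ : a * _ = e * (\int[mu]_h w h / Ig) * (b * Ig)); last first.
    by rewrite /e; field; rewrite !gt_eqF.
  by rewrite ler_wpM2l// mulr_ge0 ?divr_ge0// ltW.
have cMg c : continuous (fun h => c * g h).
  by apply: contM => //; exact: cont_cst.
have lin c : \int[mu]_h (f h - c * g h) = Jf - c * Ig.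
  rewrite RintegralB//; try exact: continuous_integrable_SO2.
  by rewrite RintegralZl//; exact: continuous_integrable_SO2.
have linT c x : T (fun h => f h - c * g h) x = T f x - c * T g x.
  rewrite /T /kernel_op -RintegralZl//; last first.
    by apply: continuous_integrable_SO2; exact: contM.
  rewrite -RintegralB//; try (apply: continuous_integrable_SO2).
  - by apply: eq_Rintegral => h _; ring.
  - exact: contM.
  - by apply: contM; [exact: cont_cst|exact: contM].
have linN c : \int[mu]_h (c * g h - f h) = c * Ig - Jf.
  rewrite RintegralB//; try exact: continuous_integrable_SO2.
  by rewrite RintegralZl//; exact: continuous_integrable_SO2.
have linTN c x : T (fun h => c * g h - f h) x = c * T g x - T f x.
  rewrite /T /kernel_op -RintegralZl//; last first.
    by apply: continuous_integrable_SO2; exact: contM.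
  rewrite -RintegralB//; try (apply: continuous_integrable_SO2).
  - by apply: eq_Rintegral => h _; ring.
  - by apply: contM; [exact: cont_cst|exact: contM].
  - exact: contM.
have Jm : 0 <= Jf - m * Ig.
  by rewrite -lin; apply: Rintegral_ge0 => h _; rewrite subr_ge0; case: (H h).
have JM : 0 <= M * Ig - Jf.
  by rewrite -linN; apply: Rintegral_ge0 => h _; rewrite subr_ge0; case: (H h).
exists (m + e * ((Jf - m * Ig) / Ig)), (M - e * ((M * Ig - Jf) / Ig)); split.
- by rewrite lerDl mulr_ge0 ?divr_ge0// ltW.
- by rewrite gerBl mulr_ge0 ?divr_ge0// ltW.
- by field; rewrite gt_eqF.
- move=> x; split.
    have := low _ (contB fc (@cMg m)) _ x; rewrite lin linT => Hx.
    rewrite mulrDl -lerBrDl; apply: Hx.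
    by move=> h; rewrite subr_ge0; case: (H h).
  have := low _ (contB (@cMg M) fc) _ x; rewrite linN linTN => Hx.
  rewrite mulrBl lerBrDr -lerBrDl; apply: Hx.
  by move=> h; rewrite subr_ge0; case: (H h).
Qed.

Section schrodinger_map.
Variables rho0 rho1 : SO2 R -> R.
Hypotheses (rho0C : Cplus rho0) (rho1C : Cplus rho1).

Definition schrodinger_map phi : SO2 R -> R :=
  fun x => rho1 x / T (fun h => rho0 h / T phi h) x.

Let F := schrodinger_map.

Lemma schrodinger_map_Cplus phi : Cplus phi -> Cplus (F phi).
Proof.
move=> phiC; apply: Cplus_div => //; apply: kernel_op_Cplus.
by apply: Cplus_div => //; exact: kernel_op_Cplus.
Qed.

Let ratio_between_inv rho m M g f : Cplus rho -> Cplus f -> Cplus g ->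
  0 < m -> ratio_between m M g f ->
  ratio_between M^-1 m^-1 (fun x => rho x / g x) (fun x => rho x / f x).
Proof.
move=> [_ r0] fC gC m0 H x.
have mM := ratio_between_le gC H; have M0 : 0 < M by lra.
have [_ f0] := fC; have [_ g0] := gC; have [h1 h2] := H x.
have rx := r0 x; have fx := f0 x; have gx := g0 x.
split.
  rewrite mulrCA ler_pM2l// -invfM lef_pV2 ?posrE ?mulr_gt0//.
by rewrite mulrCA ler_pM2l// -invfM lef_pV2 ?posrE ?mulr_gt0.
Qed.

(** Inversion does not act linearly on the length of an interval of ratios, but
    it preserves inclusions: the second application of the kernel keeps the
    inverted interval nested, so the second inversion returns a subinterval of
    the one that the first application contracted. *)
Lemma schrodinger_map_contraction : exists2 c, 0 <= c < 1 &
  forall m M f g, Cplus f -> Cplus g -> 0 < m -> ratio_between m M g f ->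
  exists m' M', [/\ m <= m', M' <= M, M' - m' = c * (M - m)
                  & ratio_between m' M' (F g) (F f)].
Proof.
have [c c01 Tc] := kernel_op_contraction; exists c => // m M f g fC gC m0 H.
have [m' [M' [mm MM cE HT]]] := Tc _ _ _ _ fC gC H.
exists m', M'; split => //.
have m'0 : 0 < m' by lra.
have TfC := kernel_op_Cplus fC; have TgC := kernel_op_Cplus gC.
have M'0 : 0 < M' by have := ratio_between_le TgC HT; lra.
have inv := ratio_between_inv rho0C TfC TgC m'0 HT.
have fC' := Cplus_div rho0C TfC; have gC' := Cplus_div rho0C TgC.
have [m1 [M1 [mm1 MM1 _ HT1]]] := Tc _ _ _ _ fC' gC' inv.
have Tg'C := kernel_op_Cplus gC'.
have {}HT1 := ratio_betweenW Tg'C mm1 MM1 HT1.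
have M'V0 : 0 < M'^-1 by rewrite invr_gt0.
have := ratio_between_inv rho1C (kernel_op_Cplus fC') Tg'C M'V0 HT1.
by rewrite !invrK.
Qed.

Lemma schrodinger_map_unique phi phi' : Cplus phi -> Cplus phi' ->
  phi =1 F phi -> phi' =1 F phi' ->
  exists2 a : R, 0 < a & forall x, phi' x = a * phi x.
Proof.
move=> phiC phi'C fix1 fix2.
have [c c01 Fc] := schrodinger_map_contraction.
have [m [M [m0 H]]] := Cplus_ratio phi'C phiC.
have E1 : F phi = phi by apply/funext => x; rewrite -fix1.
have E2 : F phi' = phi' by apply/funext => x; rewrite -fix2.
have step n : exists m' M', [/\ 0 < m', M' - m' = c ^+ n * (M - m)
    & ratio_between m' M' phi phi'].
  elim: n => [|n [m' [M' [m'0 MmE H']]]].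
    by exists m, M; rewrite expr0 mul1r.
  have [m1 [M1 [mm1 _ ME H1]]] := Fc _ _ _ _ phi'C phiC m'0 H'.
  exists m1, M1; split; first lra.
    by rewrite ME MmE exprS mulrA.
  by move: H1; rewrite E1 E2.
have [_ p0] := phiC; have [_ p'0] := phi'C.
pose r x := phi' x / phi x.
have rlt n x : r x - r oneSO2 <= c ^+ n * (M - m) /\
    r oneSO2 - r x <= c ^+ n * (M - m).
  have [m' [M' [_ <- H']]] := step n.
  have bd y : m' <= r y /\ r y <= M'.
    have [h1 h2] := H' y.
    by rewrite /r ler_pdivlMr// ler_pdivrMr.
  have [h1 h2] := bd x; have [h3 h4] := bd oneSO2; split; lra.
exists (r oneSO2); first by rewrite divr_gt0.
move=> x; suff -> : r oneSO2 = r x by rewrite /r divfK// gt_eqF.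
apply/eqP; rewrite -subr_eq0 -normr_le0.
apply/ler_addgt0Pl => e e0; rewrite addr0.
have [n nP] := geometric_small (M - m) c01 e0.
have [h1 h2] := rlt n x.
by rewrite ler_norml; apply/andP; split; lra.
Qed.

Section existence.
Hypothesis k_sym : forall g h : SO2 R, k g h = k h g.
Hypotheses (mass0 : \int[mu]_x rho0 x = 1) (mass1 : \int[mu]_x rho1 x = 1).

(** For [psi = rho0 / T phi], the integral of [psi * T phi] is the mass of
    [rho0], and by symmetry of the kernel the integral of [psi * T (F phi)] is
    that of [F phi * T psi = rho1]; so the ratio [T (F phi) / T phi] has
    weighted mean [1]. *)
Lemma schrodinger_map_mass m M phi : Cplus phi ->
  ratio_between m M phi (F phi) -> m <= 1 <= M.
Proof.
move=> phiC H.
have TC := kernel_op_Cplus phiC; have psiC := Cplus_div rho0C TC.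
have FC := schrodinger_map_Cplus phiC; have TFC := kernel_op_Cplus FC.
have TpsiC := kernel_op_Cplus psiC.
pose psi x := rho0 x / T phi x.
have dual : \int[mu]_x (psi x * T (F phi) x) = 1.
  rewrite (kernel_op_fubini _ k_cont psiC.1 FC.1 k_pos psiC.2 FC.2) -mass1.
  apply: eq_Rintegral => x _.
  rewrite (_ : kernel_op mu (fun g h : SO2 R => k h g) psi x = T psi x).
    by rewrite /F /schrodinger_map divfK// gt_eqF//; case: TpsiC => _; apply.
  by apply: eq_Rintegral => h _; rewrite k_sym.
have id0 c : \int[mu]_x (psi x * (c * T phi x)) = c.
  rewrite -[RHS]mulr1 -mass0 -RintegralZl//; last first.
    by apply: continuous_integrable_SO2; case: rho0C.
  apply: eq_Rintegral => x _; rewrite mulrCA /psi divfK// gt_eqF//.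
  by case: TC => _; apply.
have [c _ Tc] := kernel_op_contraction.
have [m' [M' [mm MM _ H']]] := Tc _ _ _ _ FC phiC H.
have {}H' := ratio_betweenW TC mm MM H'.
have cc a : continuous (fun x => psi x * (a * T phi x)).
  by apply: contM psiC.1 _; apply: contM TC.1; exact: cont_cst.
have ccF : continuous (fun x => psi x * T (F phi) x) by exact: contM psiC.1 TFC.1.
apply/andP; split.
  rewrite -(id0 m) -dual; apply: le_Rintegral_cont => // x.
  by rewrite ler_pM2l; [case: (H' x)|case: psiC => _; apply].
rewrite -(id0 M) -dual; apply: le_Rintegral_cont => // x.
by rewrite ler_pM2l; [case: (H' x)|case: psiC => _; apply].
Qed.

(** Since [1] lies in [[m_n, M_n]], whose length is [c ^ n * (M - m)], the
    increments of [u n = ln (phi n)] are bounded by [c ^ n * D].  With [r n] the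
    tail of that geometric series, [u n - r n] increases and [u n + r n]
    decreases, so the limit is a supremum and is within [r n] of [u n]. *)
Lemma schrodinger_map_fixpoint : exists2 phi, Cplus phi & phi =1 F phi.
Proof.
have [c c01 Fc] := schrodinger_map_contraction.
have /andP[c0 c1] := c01.
pose phi n : SO2 R -> R := iter n F (fun _ => 1).
have phiC n : Cplus (phi n).
  elim: n => [|n IH]; last exact: schrodinger_map_Cplus.
  by split => //; exact: cont_cst.
have [m [M [m0 H]]] := Cplus_ratio (phiC 1%N) (phiC 0%N).
have step n : exists m' M', [/\ m <= m', M' - m' = c ^+ n * (M - m)
    & ratio_between m' M' (phi n) (phi n.+1)].
  elim: n => [|n [m' [M' [m'0 MmE H']]]].
    by exists m, M; rewrite expr0 mul1r.
  have m'p : 0 < m' by lra.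
  have [m1 [M1 [mm1 _ ME H1]]] := Fc _ _ _ _ (phiC n.+1) (phiC n) m'p H'.
  exists m1, M1; split => //; first lra.
  by rewrite ME MmE exprS mulrA.
pose u n x := ln (phi n x).
have uc n : continuous (u n).
  move=> x; have [pc p0] := phiC n.
  exact: (continuous_comp (pc x) (continuous_ln (p0 x))).
have uK n x : expR (u n x) = phi n x.
  by apply: lnK; rewrite posrE; case: (phiC n).
pose D := (M - m) * (1 + m^-1).
have D0 : 0 <= D.
  have Mm := ratio_between_le (phiC 0%N) H.
  by rewrite mulr_ge0 ?subr_ge0// addr_ge0// invr_ge0 ltW.
have ustep n x : `|u n.+1 x - u n x| <= c ^+ n * D.
  have [m' [M' [mm' E H']]] := step n.
  have /andP[m'1 M'1] := schrodinger_map_mass (phiC n) H'.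
  have m'0 : 0 < m' by lra.
  have M'0 : 0 < M' by lra.
  have [h1 h2] := H' x; have [_ p0] := phiC n; have [_ p1] := phiC n.+1.
  have px := p0 x; have px1 := p1 x.
  have lm : ln m' <= u n.+1 x - u n x.
    by rewrite lerBrDr /u -lnM ?posrE// ler_ln ?posrE ?(mulr_gt0 m'0 px).
  have lM : u n.+1 x - u n x <= ln M'.
    by rewrite lerBlDr /u -lnM ?posrE// ler_ln ?posrE ?(mulr_gt0 M'0 px).
  have ln_le (y : R) : 0 < y -> ln y <= y - 1.
    move=> y0; rewrite [X in ln X](_ : y = 1 + (y - 1)); last by ring.
    by apply: le_ln1Dx; lra.
  have lM1 : ln M' <= M' - 1 := ln_le _ M'0.
  have lm1 : - ln m' <= m'^-1 - 1.
    by rewrite -lnV ?posrE//; apply: ln_le; rewrite invr_gt0.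
  have cn : 0 <= c ^+ n by rewrite exprn_ge0.
  have gap : 0 <= c ^+ n * (M - m) by lra.
  have mV : 0 < m^-1 by rewrite invr_gt0.
  have h3 : m'^-1 - 1 <= c ^+ n * (M - m) * m^-1.
    rewrite (_ : m'^-1 - 1 = (1 - m') * m'^-1); last by field; rewrite gt_eqF.
    apply: ler_pM; rewrite ?subr_ge0 ?invr_ge0 ?lef_pV2 ?posrE//; lra.
  have h4 : 0 <= c ^+ n * (M - m) * m^-1 by rewrite mulr_ge0// ltW.
  have DE : c ^+ n * D = c ^+ n * (M - m) + c ^+ n * (M - m) * m^-1.
    by rewrite /D; ring.
  by rewrite DE ler_norml; apply/andP; split; lra.
pose r n := c ^+ n * (D / (1 - c)).
have rE n : r n = c ^+ n * D + r n.+1.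
  by rewrite /r exprS; field; rewrite gt_eqF//; lra.
have r0 n : 0 <= r n by rewrite mulr_ge0 ?exprn_ge0 ?divr_ge0//; lra.
have inc n p x : (n <= p)%N -> u n x - r n <= u p x - r p.
  elim: p => [|p IH]; first by rewrite leqn0 => /eqP ->.
  rewrite leq_eqVlt => /predU1P[-> //|/IH]; move/le_trans; apply.
  have := ustep p x; rewrite ler_norml => /andP[h1 _]; have := rE p; lra.
have dec n p x : (n <= p)%N -> u p x + r p <= u n x + r n.
  elim: p => [|p IH]; first by rewrite leqn0 => /eqP ->.
  rewrite leq_eqVlt => /predU1P[-> //|/IH]; apply: le_trans.
  have := ustep p x; rewrite ler_norml => /andP[_ h1]; have := rE p; lra.
have cross n p x : u n x - r n <= u p x + r p.
  have h1 := inc n (maxn n p) x (leq_maxl _ _).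
  have h2 := dec p (maxn n p) x (leq_maxr _ _).
  by have := r0 (maxn n p); lra.
pose S x := [set u n x - r n | n in setT].
pose v x := sup (S x).
have supS x : has_sup (S x).
  split; first by exists (u 0%N x - r 0%N), 0%N.
  by exists (u 0%N x + r 0%N) => _ [n _ <-].
have vlow n x : u n x - r n <= v x.
  by apply: sup_upper_bound => //; exists n.
have vup n x : v x <= u n x + r n.
  apply: ge_sup; first by exists (u 0%N x - r 0%N), 0%N.
  by move=> _ [p _ <-].
have rsmall e : 0 < e -> exists n, r n <= e.
  exact: geometric_small.
have vc : continuous v.
  apply: uniform_approx_continuous => e e0; have [n rn] := rsmall e e0.
  exists (u n) => // x; have := vlow n x; have := vup n x.
  by move=> h1 h2; rewrite ler_norml; apply/andP; split; lra.
pose psi x := expR (v x).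
have psiC : Cplus psi.
  split; last by move=> x; exact: expR_gt0.
  by move=> x; exact: (continuous_comp (vc x) (@continuous_expR _ (v x))).
have near n : ratio_between (expR (- r n)) (expR (r n)) psi (phi n).
  move=> x; rewrite -uK /psi -!expRD !ler_expR; have := vlow n x.
  by have := vup n x => h1 h2; split; lra.
exists psi => // x; have FC := schrodinger_map_Cplus psiC.
have [_ F0] := FC; have Fx := F0 x.
suff : ln (F psi x) = v x by rewrite /psi => <-; rewrite lnK// posrE.
apply/eqP; rewrite -subr_eq0 -normr_le0.
apply/ler_addgt0Pl => e e0; rewrite addr0.
have e20 : 0 < e / 2 by lra.
have [n rn] := rsmall _ e20.
have [m1 [M1 [mm1 MM1 _ H1]]] := Fc _ _ _ _ (phiC n) psiC (expR_gt0 _) (near n).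
have {}H1 := ratio_betweenW FC mm1 MM1 H1.
have [h1 h2] := H1 x; have [h3 h4] := near n.+1 x.
have FE : F psi x = expR (ln (F psi x)) by apply/esym/lnK; rewrite posrE.
have phiE : F (phi n) = phi n.+1 by [].
move: h1 h2 h3 h4; rewrite phiE -uK {1 2}FE /psi -!expRD !ler_expR => h1 h2 h3 h4.
have := r0 n.+1; have := rE n; have : 0 <= c ^+ n * D by rewrite mulr_ge0 ?exprn_ge0.
by move=> q1 q2 q3; rewrite ler_norml; apply/andP; split; lra.
Qed.

End existence.

End schrodinger_map.
End projective_contraction.

Lemma smooth2_continuous {R : realType} (k : SO2 R -> SO2 R -> R) : smooth2 k ->
  continuous (fun u : SO2 R * SO2 R => k u.1 u.2).
Proof. by move=> /(_ 0%N)[kc _]; exact: continuous2_of_rot. Qed.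

Unset Implicit Arguments.

Theorem theorem1 (R : realType) (sigma : R) (hsigma : 0 < sigma)
    (ip : 'M[R]_2 -> 'M[R]_2 -> R) (hip : Ad_invariant_inner_product ip)
    (mu : probability (SO2 R) R) (hmu : is_haar mu)
    (T : R -> L2 mu -> L2 mu) (hT : heat_semigroup ip sigma T)
    (k1 : SO2 R -> SO2 R -> R)
    (k1_smooth : smooth2 k1)
    (k1_pos : forall g h, 0 < k1 g h)
    (k1_kernel : is_kernel_of k1 (T 1))
    (rho0 rho1 : SO2 R -> R)
    (hrho0 : is_pdf mu rho0) (hrho1 : is_pdf mu rho1)
    (rho0_pos : Cplus rho0) (rho1_pos : Cplus rho1) :
  (exists phi1 psi0 : SO2 R -> R,
     [/\ Cplus phi1, Cplus psi0 &
         schrodinger_system (kernel_op mu k1) rho0 rho1 phi1 psi0]) /\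
  (forall phi1 psi0 phi1' psi0' : SO2 R -> R,
     Cplus phi1 -> Cplus psi0 -> Cplus phi1' -> Cplus psi0' ->
     schrodinger_system (kernel_op mu k1) rho0 rho1 phi1 psi0 ->
     schrodinger_system (kernel_op mu k1) rho0 rho1 phi1' psi0' ->
     exists a : R, [/\ 0 < a, forall g, phi1' g = a * phi1 g
                            & forall g, psi0' g = psi0 g / a]).
Proof.
have kc := smooth2_continuous k1_smooth.
have ksym := heat_kernel_sym hip hmu hT k1_kernel kc.
have mass rho : is_pdf mu rho -> \int[mu]_g rho g = 1.
  by case=> _ _ rho1E; rewrite /Rintegral rho1E.
split.
  have [phi phiC fixphi] := schrodinger_map_fixpoint kc k1_pos rho0_pos rho1_pos
    ksym (mass _ hrho0) (mass _ hrho1).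
  exists phi, (fun g => rho0 g / kernel_op mu k1 phi g); split => //.
  by apply: Cplus_div => //; exact: kernel_op_Cplus.
move=> phi psi phi' psi' phiC psiC phi'C psi'C [psiE phiE] [psi'E phi'E].
have fixE f s : (forall g, s g = rho0 g / kernel_op mu k1 f g) ->
    (forall g, f g = rho1 g / kernel_op mu k1 s g) ->
    f =1 schrodinger_map mu k1 rho0 rho1 f.
  by move=> sE fE g; rewrite fE /schrodinger_map (funext sE).
have [a a0 aE] := schrodinger_map_unique kc k1_pos rho0_pos rho1_pos phiC phi'C
  (fixE _ _ psiE phiE) (fixE _ _ psi'E phi'E).
exists a; split => // g.
have TaE : kernel_op mu k1 phi' g = a * kernel_op mu k1 phi g.
  rewrite /kernel_op -RintegralZl//; last first.
    apply: continuous_integrable_SO2; apply: contM phiC.1.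
    exact: cont_comp (@pair_continuousr _ _ g) kc.
  by apply: eq_Rintegral => h _; rewrite aE mulrCA.
by rewrite psiE psi'E TaE invfM [a^-1 * _]mulrC mulrA.
Qed.
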